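(* Let $q=p^e$ be a power of a prime $p$, let $d\geq 3$ be an odd integer with $q\equiv 1 \pmod{d(d-1)}$, and let $a,b\in\mathbb{F}_q^\times$. Let $N'_d=\#\{(x,y)\in\mathbb{F}_q^2 : y^2=x^d+ax^{d-1}+b\}$. Let $T$ be a generator of $\widehat{\mathbb{F}_q^\times}$ and put $\eta=T^{\frac{q-1}{2d}}$ (order $2d$) and $\rho=T^{\frac{q-1}{d-1}}$ (order $d-1$). Then $$N'_d=q+q^{\frac{d-1}{2}}\,\phi(-ad)\;{}_{d-1}F_{d-2}\!\left(\begin{array}{c}A_0,A_1,\ldots,A_{d-2}\\ B_1,\ldots,B_{d-2}\end{array}\Big|\ -\beta\right),$$ where $\beta=\dfrac{bd^d}{a^d(d-1)^{d-1}}$, $A_0=\eta$, the pairs $(A_i,B_i)$ for $i=1,\ldots,d-3$ are the pairs $(\eta^{2j+1},\rho^j)$ for $j\in\{1,\ldots,d-2\}\setminus\{\frac{d-1}{2}\}$ in increasing order of $j$, and $(A_{d-2},B_{d-2})=(\eta^{2d-1},\varepsilon)$; i.e. the top row is $\eta,\eta^3,\eta^5,\ldots,\eta^{d-2},\eta^{d+2},\ldots,\eta^{2d-3},\eta^{2d-1}$ and the bottom row is $\rho,\rho^2,\ldots,\rho^{\frac{d-3}{2}},\rho^{\frac{d+1}{2}},\ldots,\rho^{d-2},\varepsilon$.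
   Context: $\widehat{\mathbb{F}_q^\times}$ denotes the group of multiplicative characters of $\mathbb{F}_q^\times$; every character (including the trivial one) is extended to $\mathbb{F}_q$ by setting $\chi(0)=0$. $\varepsilon$ is the trivial character and $\phi$ the quadratic character. For characters $A,B$, $\overline{B}$ is the inverse of $B$ and $${A\choose B}:=\frac{B(-1)}{q}\sum_{x\in\mathbb{F}_q}A(x)\overline{B}(1-x).$$ For characters $A_0,\ldots,A_n,B_1,\ldots,B_n$ and $x\in\mathbb{F}_q$, the Gaussian hypergeometric series is $${}_{n+1}F_n\!\left(\begin{array}{c}A_0,A_1,\ldots,A_n\\ B_1,\ldots,B_n\end{array}\Big|\ x\right):=\frac{q}{q-1}\sum_{\chi}{A_0\chi\choose\chi}{A_1\chi\choose B_1\chi}\cdots{A_n\chi\choose B_n\chi}\chi(x),$$ the sum over all multiplicative characters $\chi$ of $\mathbb{F}_q$. *)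

(* Defs.v *)
From HB Require Import structures.
From mathcomp Require Import all_boot all_order all_algebra all_fingroup all_solvable all_field all_character.
Set Implicit Arguments. Unset Strict Implicit. Unset Printing Implicit Defensive.
Import Order.TTheory GRing.Theory Num.Theory.
Local Open Scope ring_scope.

(* Multiplicative characters of F_q^x are the (irreducible, necessarily
   linear) characters of the abelian group G = {unit F}, i.e. the 'chi_i,
   i : Iirr G.  They are algC-valued class functions in 'CF(G), which is a
   commutative unit ring (product of characters, inverse, 1 = trivial char). *)

Section Gauss.
Variable F : finFieldType.

Definition UG : {group {unit F}} := [set: {unit F}]%G.

Definition cext (chi : 'CF(UG)) (x : F) : algC :=
  if insub x is Some u then chi u else 0.

Definition cbinom (A B : 'CF(UG)) : algC :=
  cext B (-1) / (#|F|%:R) * \sum_(x : F) cext A x * cext (B^-1) (1 - x).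

Definition gaussHyp (A0 : 'CF(UG)) (As Bs : seq 'CF(UG)) (x : F) : algC :=
  (#|F|%:R / (#|F|%:R - 1)) *
  \sum_(i : Iirr UG)
     (cbinom (A0 * 'chi_i) 'chi_i *
      \prod_(ab <- zip As Bs) cbinom (ab.1 * 'chi_i) (ab.2 * 'chi_i) *
      cext 'chi_i x).

Definition qchar (x : F) : algC :=
  if x == 0 then 0 else if [exists y : F, y ^+ 2 == x] then 1 else -1.

Definition Nd (d : nat) (a b : F) : nat :=
  #|[set xy : F * F | xy.2 ^+ 2 == xy.1 ^+ d + a * xy.1 ^+ d.-1 + b]|.

End Gauss.

(* Main.v *)
Require Import Defs.
From HB Require Import structures.
From mathcomp Require Import all_boot all_order all_algebra all_fingroup all_solvable all_field all_character.
From mathcomp Require Import ring zify.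
Set Implicit Arguments. Unset Strict Implicit. Unset Printing Implicit Defensive.
Import Order.TTheory GRing.Theory Num.Theory.
Local Open Scope ring_scope.

(** Fix a nontrivial additive character [th] and let [g A] be the Gauss sum of [A].
    With [u = s x^d], [v = s a x^(d-1)], the sum [g phi * sum_x phi (x^d + a x^(d-1) + b)]
    becomes, up to [g phi * phi b], the sum over all [chi] of
    [g (1/chi) g (phi chi^d) g (chi^(1-d)) chi (b/a^d)] times [phi a / (q-1)].  The
    hypergeometric coefficients are products of Gauss sums too, and the Hasse-Davenport
    product formula for [m = d] and [m = d-1] identifies them with these terms, except that
    [chi = phi] is weighted by [q] instead of [1], which accounts for [phi b].

    The product formula is obtained by comparing two L-functions of degree [m].  For monic
    [f] put [lam A m f = A ((-1)^deg f * f(0)) * th (p_m f)], [p_m] the m-th power sum of the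
    roots; this is completely multiplicative.  The sums [c_n] of [lam A m] over monic
    polynomials of degree [n] satisfy [n c_n = sum_k S_k c_(n-k)], where [S_k] is a character
    sum over the field with [q^k] elements.  By Kummer theory the [S_k] of [(A^m, m)] is the
    sum over [j < m] of those of [(A psi^j, 1)], and for the latter [c_n] is [1], [g (A psi^j)]
    for [n = 0, 1] and vanishes for larger [n]; hence [c_m] of [(A^m, m)] is
    [prod_j g (A psi^j)].  On the other hand [p_m f] is, for [deg f = m], [- m f(0)] plus a
    function of the other coefficients, so [c_m] is [A^m (1/m) g (A^m)] times a constant that
    does not depend on [A]. *)

(** * Power sums of the roots of a monic polynomial *)

(* [lia] up to the several canonical-structure paths under which [size] of a polynomial occurs. *)
Ltac size_lia :=
  repeat match goal with H : is_true (leq _ _) |- _ => move: H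
                       | H : is_true (~~ (_ == _)) |- _ => move: H
                       | H : @eq nat _ _ |- _ => move: H end;
  repeat match goal with |- context [nat_of_ord ?i] =>
    move: (ltn_ord i); generalize (nat_of_ord i) end;
  repeat match goal with |- context [@size _ (polyseq ?f)] =>
    let n := fresh "n" in set n := size (polyseq f); move: n => n end;
  lia.

Section PowerSums.
Variable R : fieldType.
Implicit Types f g h : {poly R}.

(* The remainder of ['X^k * f^`()] modulo [f]; its top coefficient is the k-th power sum of
   the roots, because [f^`()] is the sum of the [f / ('X - r)]. *)
Fixpoint psum_rem f k : {poly R} :=
  if k is k'.+1 then 'X * psum_rem f k' - (psum_rem f k')`_(size f).-2 *: f
  else f^`().

Definition psum f k : R := (psum_rem f k)`_(size f).-2.

(** For monic [f], the product of its roots. *)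
Definition snorm f : R := (-1) ^+ (size f).-1 * f`_0.

Lemma size_psum_rem f k : f \is monic -> (size (psum_rem f k) <= (size f).-1)%N.
Proof.
move=> fm; elim: k => [|k IH] /=.
  have [->|fn0] := eqVneq f 0; first by rewrite derivC size_poly0.
  by rewrite -ltnS prednK ?size_poly_gt0 // lt_size_deriv.
have sf : (0 < size f)%N by rewrite size_poly_gt0 monic_neq0.
apply/leq_sizeP => j; rewrite leq_eqVlt => /orP[/eqP <-|ltj].
  rewrite coefB coefZ -[f`_(size f).-1]/(lead_coef f) (monicP fm) mulr1 coefXM.
  case: (size f) sf IH => [|[|n]] //= _ => [/leq_sizeP->//|_].
  by rewrite subr0.
  by rewrite subrr.
rewrite coefB coefZ [f`_j]nth_default ?mulr0 ?subr0; last by size_lia.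
by rewrite coefXM; case: j ltj => //= j ltj; rewrite nth_default //; size_lia.
Qed.

Lemma size_mul_monic2 g h : g \is monic -> h \is monic ->
  size (g * h) = ((size g).-1 + (size h).-1).+1.
Proof.
move=> gm hm; rewrite size_monicM ?monic_neq0 //.
have : (0 < size g)%N by rewrite size_poly_gt0 monic_neq0.
have : (0 < size h)%N by rewrite size_poly_gt0 monic_neq0.
by size_lia.
Qed.

(** Only the leading coefficient of [h] meets the top possible coefficient of [r]; for [n = 0],
    where the indices truncate, [r] is zero. *)
Lemma coef_mul_monic (r h : {poly R}) n : h \is monic -> (size r <= n)%N ->
  (r * h)`_(n + (size h).-1).-1 = r`_n.-1.
Proof.
move=> hm; case: n => [|n] sr.
  by move: sr; rewrite leqn0 size_poly_eq0 => /eqP->; rewrite mul0r !coef0.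
rewrite addSn /= coefMr (bigD1 (inord (size h).-1)) //= inordK; last by rewrite ltnS leq_addl.
rewrite addnK -[h`_(size h).-1]/(lead_coef h) (monicP hm) mulr1 big1 ?addr0 //.
move=> i ne; have {}ne : nat_of_ord i != (size h).-1.
  by apply: contra ne => /eqP e; apply/eqP/val_inj; rewrite /= inordK ?ltnS ?leq_addl.
have [lt|ge] := ltnP i (size h).-1; last by rewrite [h`_i]nth_default ?mulr0 //; size_lia.
by rewrite [r`_ _]nth_default ?mul0r //; size_lia.
Qed.

(** The product rule at [k = 0]. The recursion preserves it because the two top coefficients add. *)
Lemma psum_remM g h k : g \is monic -> h \is monic ->
  psum_rem (g * h) k = psum_rem g k * h + g * psum_rem h k.
Proof.
move=> gm hm; elim: k => [|k IH] /=; first by rewrite derivM.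
have sgh := size_mul_monic2 gm hm.
have -> : (psum_rem (g * h) k)`_(size (g * h)).-2 =
     (psum_rem g k)`_(size g).-2 + (psum_rem h k)`_(size h).-2.
  rewrite IH coefD sgh /= [g * _]mulrC; congr (_ + _).
    by rewrite coef_mul_monic ?size_psum_rem.
  by rewrite addnC coef_mul_monic ?size_psum_rem.
rewrite IH -!mul_polyC polyCD; ring.
Qed.

Lemma psumM g h k : g \is monic -> h \is monic ->
  psum (g * h) k = psum g k + psum h k.
Proof.
move=> gm hm; rewrite /psum psum_remM // coefD size_mul_monic2 //= [g * _]mulrC.
congr (_ + _); first by rewrite coef_mul_monic ?size_psum_rem.
by rewrite addnC coef_mul_monic ?size_psum_rem.
Qed.

Lemma psum1 k : psum 1 k = 0.
Proof.
by apply: (@addrI _ (psum 1 k)); rewrite addr0 -psumM ?monic1 // mulr1.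
Qed.

Lemma psum_XsubC r k : psum ('X - r%:P) k = r ^+ k.
Proof.
rewrite /psum size_XsubC /=.
suff -> : psum_rem ('X - r%:P) k = (r ^+ k)%:P by rewrite coefC.
elim: k => [|k IH] /=; first by rewrite derivXsubC.
rewrite IH size_XsubC coefC /= -mul_polyC exprS polyCM; ring.
Qed.

Lemma psum_prod_XsubC (s : seq R) k :
  psum (\prod_(x <- s) ('X - x%:P)) k = \sum_(x <- s) x ^+ k.
Proof.
elim: s => [|x s IH]; first by rewrite !big_nil psum1.
by rewrite !big_cons psumM ?monicXsubC ?monic_prod_XsubC // psum_XsubC IH.
Qed.

(** The constant leaves the derivative alone and reaches the top coefficient only after [m] steps,
    multiplied by the zeroth power sum [m]. *)
Lemma psum_addC f c m : (0 < m)%N -> f \is monic -> size f = m.+1 ->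
  psum (f + c%:P) m = psum f m - m%:R * c.
Proof.
move=> m0 fm sf.
have sfc : size (f + c%:P) = m.+1.
  by rewrite size_polyDl ?sf //; apply: leq_ltn_trans (size_polyC_leq1 c) _.
rewrite /psum sf sfc /=.
(* The difference of the remainders has degree below [k], so it is invisible in degree [m.-1] as
   long as [k < m]. *)
have H k : (k <= m)%N -> psum_rem (f + c%:P) k =
    psum_rem f k - c *: \sum_(i < k) psum f i *: 'X^(k.-1 - i).
  elim: k => [|k IH] km.
    by rewrite big_ord0 scaler0 subr0 /= derivD derivC addr0.
  rewrite /= sfc sf /= IH; last by size_lia.
  have -> : (psum_rem f k - c *: (\sum_(i < k) psum f i *: 'X^(k.-1 - i)))`_m.-1
      = (psum_rem f k)`_m.-1.
    rewrite coefB coefZ coef_sum big1 ?mulr0 ?subr0 // => i _.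
    by rewrite coefZ coefXn; case: eqP => [|_]; rewrite ?mulr0 //; have := ltn_ord i; size_lia.
  have S : \sum_(i < k.+1) psum f i *: 'X^(k - i) =
      'X * (\sum_(i < k) psum f i *: 'X^(k.-1 - i)) + (psum f k)%:P.
    rewrite big_ord_recr /= subnn expr0 alg_polyC mulr_sumr; congr (_ + _).
    apply: eq_bigr => i _; rewrite -scalerAr -exprS; congr (_ *: 'X^_).
    by have := ltn_ord i; size_lia.
  rewrite S {3}/psum sf /= -!mul_polyC; ring.
rewrite H // coefB coefZ coef_sum; congr (_ - _).
case: m m0 sf sfc H => // m _ sf _ _.
rewrite big_ord_recl /= big1 ?addr0 => [|i _].
  rewrite coefZ coefXn subn0 eqxx mulr1 /psum sf /= coef_deriv /=.
  by rewrite -[f`_m.+1]/(f`_m.+2.-1) -sf -/(lead_coef f) (monicP fm) mulrC.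
rewrite coefZ coefXn; case: eqP; rewrite ?mulr0 // /bump /=.
by have := ltn_ord i; size_lia.
Qed.

Lemma snormM g h : g \is monic -> h \is monic -> snorm (g * h) = snorm g * snorm h.
Proof.
move=> gm hm; rewrite /snorm size_mul_monic2 //= exprD -!horner_coef0 hornerM; ring.
Qed.

Lemma snorm1 : snorm 1 = 1.
Proof. by rewrite /snorm size_poly1 coef1 mulr1. Qed.

Lemma snorm_prod_XsubC (s : seq R) :
  snorm (\prod_(x <- s) ('X - x%:P)) = \prod_(x <- s) x.
Proof.
elim: s => [|x s IH]; first by rewrite !big_nil snorm1.
rewrite !big_cons snormM ?monicXsubC ?monic_prod_XsubC // IH.
by rewrite /snorm size_XsubC -horner_coef0 hornerXsubC /=; congr (_ * _); ring.
Qed.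

End PowerSums.

Lemma psum_map (R R' : fieldType) (j : {rmorphism R -> R'}) f k :
  psum (map_poly j f) k = j (psum f k).
Proof.
have H : psum_rem (map_poly j f) k = map_poly j (psum_rem f k).
  elim: k => [|k IH] /=; first by rewrite deriv_map.
  by rewrite IH size_map_poly coef_map rmorphB rmorphM /= map_polyX map_polyZ.
by rewrite /psum H size_map_poly coef_map.
Qed.

Lemma snorm_map (R R' : fieldType) (j : {rmorphism R -> R'}) f :
  snorm (map_poly j f) = j (snorm f).
Proof. by rewrite /snorm size_map_poly coef_map rmorphM rmorphXn rmorphN1. Qed.

(** * Sums over monic polynomials of a given degree *)

Section Monics.
Variable F : finFieldType.

(** The lower coefficients form a row vector, so that sums range over a finite type. *)
Definition mon n (v : 'rV[F]_n) : {poly F} := 'X^n + rVpoly v.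

Lemma size_mon n (v : 'rV[F]_n) : size (mon v) = n.+1.
Proof. by rewrite /mon size_polyDl ?size_polyXn // ltnS size_poly. Qed.

Lemma mon_monic n (v : 'rV[F]_n) : mon v \is monic.
Proof.
by rewrite monicE lead_coefDl ?lead_coefXn // size_polyXn ltnS size_poly.
Qed.

Lemma monP n (f : {poly F}) : f \is monic -> size f = n.+1 ->
  mon (poly_rV (f - 'X^n) : 'rV_n) = f.
Proof.
move=> fm sf; rewrite /mon poly_rV_K; first by rewrite addrC subrK.
apply/leq_sizeP => j; rewrite leq_eqVlt coefB coefXn => /orP[/eqP <-|lt].
  by rewrite eqxx -[n]/(n.+1.-1) -sf -/(lead_coef f) (monicP fm) subrr.
by rewrite nth_default ?sf // gtn_eqF // subrr.
Qed.

Lemma mon_inj n : injective (@mon n).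
Proof. by move=> u v /addrI/(can_inj rVpolyK). Qed.

(** Division by [h] maps these multiples bijectively to the monic polynomials of degree [n - k]. *)
Lemma sum_mon_dvd (lam : {poly F} -> algC) n k (h : {poly F}) :
  h \is monic -> size h = k.+1 -> (k <= n)%N ->
  (forall f g, f \is monic -> g \is monic -> lam (f * g) = lam f * lam g) ->
  \sum_(v : 'rV[F]_n | h %| mon v) lam (mon v) =
  lam h * \sum_(w : 'rV[F]_(n - k)) lam (mon w).
Proof.
move=> hm sh kn lamM.
pose up (w : 'rV[F]_(n - k)) : 'rV[F]_n := poly_rV (h * mon w - 'X^n).
have upE w : mon (up w) = h * mon w.
  apply: monP; first by rewrite monicMl ?mon_monic.
  by rewrite size_mul_monic2 ?mon_monic // sh size_mon /=; size_lia.
pose dn (v : 'rV[F]_n) : 'rV[F]_(n - k) := poly_rV (mon v %/ h - 'X^(n - k)).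
have dnE v : h %| mon v -> h * mon (dn v) = mon v.
  move=> hv; have e : mon v = mon v %/ h * h by rewrite divpK.
  have qm : mon v %/ h \is monic.
    by rewrite -(monicMr _ hm) -e mon_monic.
  rewrite monP //; first by rewrite mulrC -e.
  have := size_mon v; rewrite {1}e size_mul_monic2 // sh /=.
  have : (0 < size (mon v %/ h)%R)%N by rewrite size_poly_gt0 monic_neq0.
  by size_lia.
rewrite (reindex_onto up dn) /=; last by move=> v hv; apply: mon_inj; rewrite upE dnE.
rewrite mulr_sumr; apply: eq_big => [w|w _].
  rewrite upE dvdp_mulr //=; apply/eqP/mon_inj.
  have := dnE (up w); rewrite upE dvdp_mulr // => /(_ isT).
  by apply: mulfI; apply: monic_neq0.
by rewrite upE lamM // mon_monic.
Qed.

End Monics.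

(** * Frobenius orbits in an extension field *)

Definition frob {F : finFieldType} {L : fieldExtType F} (x : L) : L := x ^+ #|F|.

Lemma pnat_card_ext (F : finFieldType) (L : fieldExtType F) :
  [pchar L].-nat #|F|.
Proof.
have [p p_pr pF] := finPcharP F.
have pL : p \in [pchar L] by rewrite (rmorph_pchar (GRing.in_alg L)).
rewrite (eq_pnat _ (pcharf_eq pL)) [#|F|](card_pprimeChar pF).
by rewrite pnatX pnat_id.
Qed.

Lemma frob_is_zmod_morphism (F : finFieldType) (L : fieldExtType F) :
  zmod_morphism (@frob F L).
Proof.
move=> x y; rewrite /frob exprDn_pchar ?pnat_card_ext //.
by rewrite exprNn_pchar ?pnat_card_ext.
Qed.

Lemma frob_is_monoid_morphism (F : finFieldType) (L : fieldExtType F) :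
  monoid_morphism (@frob F L).
Proof. by split=> [|x y]; rewrite /frob ?expr1n ?exprMn. Qed.

HB.instance Definition _ (F : finFieldType) (L : fieldExtType F) :=
  GRing.isZmodMorphism.Build L L (@frob F L) (@frob_is_zmod_morphism F L).
HB.instance Definition _ (F : finFieldType) (L : fieldExtType F) :=
  GRing.isMonoidMorphism.Build L L (@frob F L) (@frob_is_monoid_morphism F L).

Section Extension.
Variables (F : finFieldType) (L : fieldExtType F).
Local Notation q := #|F|.
Local Notation inL := (GRing.in_alg L).
Implicit Types (x z : L) (k : nat).

Lemma iter_frobE k z : iter k frob z = z ^+ (q ^ k).
Proof. by elim: k => [|k IH] //=; rewrite IH /frob -exprM -expnSr. Qed.

Lemma frob_in_alg a : frob (inL a) = inL a.
Proof. by rewrite /frob -rmorphXn /= expf_card. Qed.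

(** The elements of [F] already exhaust the roots of ['X^q - 'X]. *)
Lemma frob_fixed x : frob x = x -> exists a, inL a = x.
Proof.
move=> fx.
have : root (map_poly inL ('X^q - 'X)) x.
  by rewrite rmorphB /= map_polyXn map_polyX rootE !hornerE [x ^+ _]fx subrr.
rewrite finField_genPoly rmorph_prod /= rootE horner_prod => /prodf_eq0[a _].
by rewrite map_polyXsubC -rootE root_XsubC => /eqP->; exists a.
Qed.

(* Inverse of the embedding of [F] into [L]; [0] outside its image. *)
Definition retr x : F := odflt 0 [pick a | inL a == x].

Lemma retrK x : frob x = x -> inL (retr x) = x.
Proof.
case/frob_fixed => a <-; rewrite /retr; case: pickP => [b /eqP //|].
by move/(_ a); rewrite eqxx.
Qed.

Lemma in_algK a : retr (inL a) = a.
Proof. exact/(fmorph_inj inL)/retrK/frob_in_alg. Qed.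

Lemma map_frob_in_alg (f : {poly F}) :
  map_poly frob (map_poly inL f) = map_poly inL f.
Proof. by apply/polyP => i; rewrite !coef_map; apply: frob_in_alg. Qed.

Lemma iter_frob_cancel i j z : (i <= j)%N ->
  iter i frob z = iter j frob z -> iter (j - i) frob z = z.
Proof.
move=> le_ij; rewrite -{1}(subnKC le_ij) iterD.
have inj : injective (iter i (@frob F L)).
  by elim: (i) => //= n IH x y e; apply: IH; apply: (fmorph_inj frob).
by move/inj/esym.
Qed.

(** For [k > 0] and [z] fixed by the [k]-th Frobenius iterate, this is the characteristic polynomial
    of [z] over [F] in the field with [q ^ k] elements. *)
Definition cpoly z k : {poly L} := \prod_(x <- traject frob z k) ('X - x%:P).

Lemma cpolyS z k : cpoly z k.+1 = ('X - z%:P) * cpoly (frob z) k.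
Proof. by rewrite /cpoly /= big_cons. Qed.

Lemma cpoly_frob z k : iter k frob z = z -> map_poly frob (cpoly z k) = cpoly z k.
Proof.
case: k => [|k] zk; first by rewrite /cpoly /= big_nil rmorph1.
rewrite /cpoly map_prod_XsubC -(big_map frob xpredT (fun x => 'X - x%:P)).
(* Frobenius rotates the closed orbit, which leaves the product unchanged. *)
have -> : [seq frob i | i <- traject frob z k.+1] = rcons (traject frob (frob z) k) z.
  rewrite -[X in rcons _ X]zk iterSr -trajectSr.
  by elim: (k.+1) (z) => //= n IH y; rewrite IH.
by rewrite big_rcons /= big_cons mulrC.
Qed.

Lemma cpoly_monic z k : cpoly z k \is monic.
Proof. exact: monic_prod_XsubC. Qed.

Lemma size_cpoly z k : size (cpoly z k) = k.+1.
Proof. by rewrite /cpoly size_prod_XsubC size_traject. Qed.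

Lemma cpolyD z i j : iter i frob z = z -> cpoly z (i + j) = cpoly z i * cpoly z j.
Proof.
move=> zi; rewrite /cpoly -big_cat /=; congr (\prod_(x <- _) _).
by rewrite trajectD zi.
Qed.

Definition dcpoly z k : {poly F} := map_poly retr (cpoly z k).

Lemma dcpolyE z k : iter k frob z = z -> map_poly inL (dcpoly z k) = cpoly z k.
Proof.
move=> zk; have r0 : retr 0 = 0 by rewrite -(rmorph0 inL) in_algK.
apply/polyP => i; rewrite coef_map coef_map_id0 //; apply: retrK.
by rewrite -coef_map cpoly_frob.
Qed.

Lemma dcpoly_monic z k : iter k frob z = z -> dcpoly z k \is monic.
Proof.
by move=> zk; rewrite -(map_monic inL) dcpolyE // cpoly_monic.
Qed.

Lemma size_dcpoly z k : iter k frob z = z -> size (dcpoly z k) = k.+1.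
Proof. by move=> zk; rewrite -(size_map_poly inL) dcpolyE // size_cpoly. Qed.

(** On the field with [q ^ k] elements, this and [ftrace] are the norm and the trace to [F]. *)
Definition fnorm k z : F := retr (\prod_(x <- traject frob z k) x).
Definition ftrace k z : F := retr (\sum_(x <- traject frob z k) x).

Lemma snorm_dcpoly z k : iter k frob z = z -> snorm (dcpoly z k) = fnorm k z.
Proof.
by move=> zk; rewrite /fnorm -snorm_prod_XsubC -/(cpoly z k) -dcpolyE // snorm_map; apply/esym/in_algK.
Qed.

Lemma psum_dcpoly z k m : iter k frob z = z ->
  psum (dcpoly z k) m = ftrace k (z ^+ m).
Proof.
move=> zk; have -> : ftrace k (z ^+ m) = retr (\sum_(x <- traject frob z k) x ^+ m).
  rewrite /ftrace -(big_map (fun x => x ^+ m) xpredT id) /=; congr (retr (\sum_(x <- _) _)).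
  elim: (k) (z) => //= n IH y; rewrite -IH.
  by rewrite rmorphXn.
by rewrite -psum_prod_XsubC -/(cpoly z k) -dcpolyE // psum_map; apply/esym/in_algK.
Qed.

(* Removing the Frobenius orbit of [z] (of length [d], say) from [s] lowers the multiplicity of
   [z] by one and shifts the admissible [k] by [d], losing exactly [k = d]. *)
Lemma mult_count (s : seq L) z N : (size s <= N)%N ->
  map_poly frob (\prod_(x <- s) ('X - x%:P)) = \prod_(x <- s) ('X - x%:P) ->
  (\sum_(1 <= k < N.+1 | (iter k frob z == z)
      && (cpoly z k %| \prod_(x <- s) ('X - x%:P))%R) 1)%N = count_mem z s.
Proof.
have [n] := ubnP (size s); elim: n s N => // n IH s N /ltnSE le_sn le_sN frs.
set G := \prod_(x <- s) _ in frs *.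
have [zs|zs] := boolP (z \in s); last first.
  rewrite (count_memPn zs) big_nat_cond big1 // => k /andP[/andP[k0 _] /andP[_]].
  case: k k0 => // k _; rewrite cpolyS => /(dvdp_trans (dvdp_mulr _ (dvdpp _))).
  by rewrite dvdp_XsubCl root_prod_XsubC (negPf zs).
have rs i : iter i frob z \in s.
  elim: i => //= i; rewrite -!root_prod_XsubC -/G => ri.
  by rewrite -frs fmorph_root.
(* All iterates of [z] lie in [s], so two of the first [(size s).+1] coincide; [d] is the least
   period. *)
have /ex_minnP[d /andP[d0 /eqP zd] dmin] : exists d, (0 < d)%N && (iter d frob z == z).
  have /(uniqPn 0)[i [j [ij]]] : ~~ uniq (mkseq (fun i => iter i frob z) (size s).+1).
    apply/negP => u; have := uniq_leq_size u (s2 := s).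
    rewrite size_mkseq ltnn => H; suff: false by [].
    by apply: H => x /mapP[i _ ->].
  rewrite size_mkseq => js; rewrite !nth_mkseq //; last exact: ltn_trans js.
  move/(iter_frob_cancel (ltnW ij)) => e; exists (j - i)%N.
  by rewrite subn_gt0 ij e eqxx.
have ut : uniq (traject frob z d).
  apply/(uniqP z) => i j; rewrite !inE size_traject => id jd.
  rewrite !nth_traject // => eij.
  wlog ij : i j id jd eij / (i <= j)%N.
    by move=> W; have [/W->|/ltnW/W->] := leqP i j.
  apply/eqP; rewrite eqn_leq ij leqNgt; apply/negP => lt.
  have := dmin (j - i)%N; rewrite subn_gt0 lt (iter_frob_cancel ij eij) eqxx => /(_ isT).
  by lia.
have PG : cpoly z d %| G.
  apply: uniq_roots_dvdp; last by rewrite uniq_rootsE.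
  by apply/allP => x /trajectP[i _ ->]; rewrite root_prod_XsubC.
have [g eG] : exists g, G = cpoly z d * g by case/dvdpP: PG => g ->; exists g; rewrite mulrC.
have gm : g \is monic by rewrite -(monicMr _ (cpoly_monic z d)) mulrC -eG monic_prod_XsubC.
have [s' eg] : exists s', g = \prod_(x <- s') ('X - x%:P).
  have /dvdp_prod_XsubC[b] : g %| G by rewrite eG dvdp_mull.
  by rewrite eqp_monic ?monic_prod_XsubC // => /eqP->; eexists.
have ps : perm_eq s (traject frob z d ++ s').
  by apply: prod_XsubC_eq; rewrite big_cat /= -eg -eG.
have Pn0 : cpoly z d != 0 by rewrite monic_neq0 ?cpoly_monic.
have frs' : map_poly frob g = g.
  by apply: (mulfI Pn0); rewrite -{1}(cpoly_frob zd) -rmorphM /= -eG.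
have ss : size s = (d + size s')%N by rewrite (perm_size ps) size_cat size_traject.
rewrite (seq.permP ps) count_cat count_uniq_mem //.
have -> : z \in traject frob z d by apply/trajectP; exists 0%N.
move: le_sn le_sN; rewrite ss => le_sn le_sN.
have lt1 : (size s' < n)%N by move: (size s') le_sn => i; lia.
have lt2 : (size s' <= N - d)%N by move: (size s') le_sN => i; lia.
have dN : (d <= N)%N by move: (size s') le_sN => i; lia.
rewrite -(IH s' (N - d)%N) -?eg //.
(* One full orbit cancels, so the condition at [d + k] for [s] is the condition at [k] for [s']. *)
have cond k : (iter (d + k) frob z == z) && (cpoly z (d + k) %| G)
   = (iter k frob z == z) && (cpoly z k %| g).
  by rewrite eG cpolyD // dvdp_mul2l // addnC iterD zd.
rewrite (big_cat_nat (n := d)) ?leqW //=.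
rewrite big_nat_cond big1 ?add0n; last first.
  move=> k /andP[/andP[k0 kd] /andP[zk _]].
  by have := dmin k; rewrite k0 zk => /(_ isT); lia.
(* The term [k = d] corresponds to [k = 0] for [s'], where [cpoly z 0 = 1], so it always counts
   one. *)
rewrite big_mkcond /= big_ltn; last by lia.
rewrite -{1 2}[d]addn0 cond /= eqxx /cpoly /= big_nil dvd1p; congr (_ + _)%N.
rewrite -/cpoly [RHS]big_mkcond /= -[d.+1]add1n (_ : N.+1 = (N - d).+1 + d)%N; last by lia.
by rewrite big_addn addnK; apply: eq_bigr => k _; rewrite addnC cond.
Qed.

End Extension.

(** * Characters and Gauss sums *)

Section Characters.
Variable F : finFieldType.
Implicit Types (A B : 'CF(UG F)) (x y : F).

Lemma cext_val A (u : {unit F}) : cext A (val u) = A u.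
Proof. by rewrite /cext valK. Qed.

Lemma unit_valP x : x != 0 -> exists u : {unit F}, val u = x.
Proof. by rewrite -unitfE => ux; exists (Sub x ux); rewrite SubK. Qed.

Lemma cext0 A : cext A 0 = 0.
Proof. by rewrite /cext insubF // unitr0. Qed.

Lemma in_UG (u : {unit F}) : u \in UG F.
Proof. by rewrite inE. Qed.

Lemma cext_cfun1 x : cext 1 x = (x != 0)%:R.
Proof.
have [->|/unit_valP[u <-]] := eqVneq x 0; first by rewrite cext0.
by rewrite cext_val cfun1E in_UG.
Qed.

Lemma cextMl A B x : cext (A * B) x = cext A x * cext B x.
Proof.
have [->|/unit_valP[u <-]] := eqVneq x 0; first by rewrite !cext0 mulr0.
by rewrite !cext_val cfunE.
Qed.

Lemma cextXl A n x : x != 0 -> cext (A ^+ n) x = cext A x ^+ n.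
Proof.
move=> x0; elim: n => [|n IH]; first by rewrite !expr0 cext_cfun1 x0.
by rewrite !exprS cextMl IH.
Qed.

Lemma cextM A x y : A \is a linear_char -> cext A (x * y) = cext A x * cext A y.
Proof.
move=> lA; have [->|/unit_valP[u <-]] := eqVneq x 0; first by rewrite mul0r !cext0 mul0r.
have [->|/unit_valP[v <-]] := eqVneq y 0; first by rewrite mulr0 !cext0 mulr0.
have -> : val u * val v = val (u * v)%g by [].
by rewrite !cext_val lin_charM ?in_UG.
Qed.

Lemma cext1 A : A \is a linear_char -> cext A 1 = 1.
Proof.
by move=> lA; rewrite -[1 : F]/(val (1%g : {unit F})) cext_val lin_char1.
Qed.

Lemma cextX A n x : A \is a linear_char -> cext A (x ^+ n) = cext A x ^+ n.
Proof.
move=> lA; elim: n => [|n IH]; first by rewrite !expr0 cext1.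
by rewrite !exprS cextM // IH.
Qed.

Lemma cext_neq0 A x : A \is a linear_char -> x != 0 -> cext A x != 0.
Proof. by move=> lA /unit_valP[u <-]; rewrite cext_val lin_char_neq0 ?in_UG. Qed.

Lemma cextV A x : A \is a linear_char -> cext A x^-1 = (cext A x)^-1.
Proof.
move=> lA; have [->|x0] := eqVneq x 0; first by rewrite invr0 cext0 invr0.
apply: (mulfI (cext_neq0 lA x0)).
by rewrite -cextM // divff // cext1 // divff // cext_neq0.
Qed.

Lemma cextVl A x : A \is a linear_char -> cext A^-1 x = (cext A x)^-1.
Proof.
move=> lA; have [->|x0] := eqVneq x 0; first by rewrite !cext0 invr0.
apply: (mulfI (cext_neq0 lA x0)).
by rewrite -cextMl divrr ?lin_char_unitr // cext_cfun1 x0 divff // cext_neq0.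
Qed.

Lemma mul_lin_char A B : A \is a linear_char -> B \is a linear_char -> A * B \is a linear_char.
Proof. by move=> *; rewrite rpredM. Qed.

Lemma exp_lin_char A n : A \is a linear_char -> A ^+ n \is a linear_char.
Proof. by move=> *; rewrite rpredX. Qed.

Lemma inv_lin_char A : A \is a linear_char -> A^-1 \is a linear_char.
Proof. by move=> *; rewrite rpredV. Qed.

Lemma one_lin_char : (1 : 'CF(UG F)) \is a linear_char.
Proof. exact: rpred1. Qed.

Lemma cext_inj A B : (forall x, x != 0 -> cext A x = cext B x) -> A = B.
Proof.
move=> AB; apply/cfun_inP => u _; rewrite -!cext_val; apply: AB.
by rewrite -unitfE (valP u).
Qed.

Lemma lin_char_nontrivial A : A \is a linear_char -> A != 1 ->
  exists2 x, x != 0 & cext A x != 1.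
Proof.
move=> lA A1; case: (pickP [pred x : F | (x != 0) && (cext A x != 1)]) => [x /andP[]|H].
  by exists x.
case/eqP: A1; apply: cext_inj => x x0; rewrite cext_cfun1 x0.
by have := H x; rewrite /= x0 => /negbFE/eqP.
Qed.

End Characters.

Definition additive_char (F : finFieldType) (th : F -> algC) :=
  [/\ th 0 = 1, {morph th : x y / x + y >-> x * y} & exists c, th c != 1].

(** The additive group is abelian of order above one, so it has as many linear characters as
    elements, and one of them is nontrivial. *)
Lemma additive_char_exists (F : finFieldType) : exists th : F -> algC, additive_char th.
Proof.
have aG : abelian [set: F] by apply/centsP => x _ y _; exact: addrC.
have lin i : 'chi[[set: F]]_i \is a linear_char by apply/char_abelianP.
have [i i0] : exists i : Iirr [set: F], i != 0.
  have : (1 < #|Iirr [set: F]|)%N by rewrite card_Iirr_abelian // cardsT finNzRing_gt1.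
  rewrite (cardD1 (0 : Iirr [set: F])) inE add1n ltnS => /card_gt0P[i /andP[i0 _]].
  by exists i.
exists (fun x => 'chi_i x); split.
- exact: lin_char1.
- by move=> x y; rewrite -(lin_charM (lin i)) ?inE.
case: (pickP [pred x | 'chi_i x != 1]) => [x|H]; first by exists x.
case/eqP: i0; apply: irr_inj; rewrite irr0; apply/cfun_inP => x _.
by have /negbFE/eqP := H x; rewrite cfun1E inE.
Qed.

Section AdditiveCharacter.
Variables (F : finFieldType) (th : F -> algC).
Hypothesis thP : additive_char th.

Lemma th0 : th 0 = 1. Proof. by case: thP. Qed.
Lemma thD x y : th (x + y) = th x * th y. Proof. by case: thP. Qed.

Lemma sum_th : \sum_x th x = 0.
Proof.
case: thP => _ _ [c c1]; apply/eqP; have : (1 - th c) * (\sum_x th x) == 0.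
  rewrite mulrBl mul1r subr_eq0 mulr_sumr [X in X == _](reindex_inj (addrI c)) /=.
  by apply/eqP/eq_bigr => x _; rewrite thD.
by rewrite mulf_eq0 subr_eq0 eq_sym (negPf c1).
Qed.

Lemma sum_thM c : \sum_x th (c * x) = if c == 0 then #|F|%:R else 0.
Proof.
case: eqVneq => [->|c0]; last first.
  by rewrite -[RHS]sum_th [RHS](reindex_inj (mulfI c0)).
by under eq_bigr => x _ do rewrite mul0r th0; rewrite sumr_const.
Qed.

Definition gauss (A : 'CF(UG F)) : algC := \sum_x cext A x * th x.

Lemma gauss_scale A c : A \is a linear_char -> c != 0 ->
  \sum_x cext A x * th (c * x) = (cext A c)^-1 * gauss A.
Proof.
move=> lA c0; rewrite /gauss [in RHS](reindex_inj (mulfI c0)) /= mulr_sumr.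
apply: eq_bigr => x _; rewrite cextM // !mulrA mulVf ?mul1r //.
exact: cext_neq0.
Qed.

Lemma gauss1 : gauss 1 = -1.
Proof.
have /eqP := sum_th; rewrite (bigD1 0) //= th0 addrC addr_eq0 => /eqP <-.
rewrite /gauss (bigD1 0) //= cext0 mul0r add0r.
by apply: eq_bigr => x x0; rewrite cext_cfun1 x0 mul1r.
Qed.

End AdditiveCharacter.

(** * Newton's identities for sums over monic polynomials *)

Section NewtonSeries.
Variable M : nat.
Implicit Types P Q S : {poly algC}.

(** Up to degree [M], [S] is [X] times the logarithmic derivative of [P], written without division;
    coefficientwise these are Newton's identities. *)
Definition log_deriv P S := 'X^(M.+1) %| 'X * P^`() - P * S.

Lemma dvdXnP n P : reflect (forall i, (i < n)%N -> P`_i = 0) ('X^n %| P).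
Proof.
apply: (iffP idP) => [/dvdpP[r ->] i lt|H]; first by rewrite coefMXn lt.
rewrite -(poly_take_drop n P) (_ : take_poly n P = 0) ?add0r ?dvdp_mull //.
by apply/polyP => i; rewrite coef_take_poly coef0; case: ifP => // /H.
Qed.

Lemma log_derivM P Q S T :
  log_deriv P S -> log_deriv Q T -> log_deriv (P * Q) (S + T).
Proof.
rewrite /log_deriv => PS QT.
have -> : 'X * (P * Q)^`() - P * Q * (S + T) =
  ('X * P^`() - P * S) * Q + ('X * Q^`() - Q * T) * P.
  by rewrite derivM; ring.
by rewrite dvdp_add // dvdp_mulr.
Qed.

Lemma log_deriv_prod (I : Type) (r : seq I) (P S : I -> {poly algC}) :
  (forall i, log_deriv (P i) (S i)) ->
  log_deriv (\prod_(i <- r) P i) (\sum_(i <- r) S i).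
Proof.
move=> H; elim: r => [|i r IH].
  by rewrite !big_nil /log_deriv derivC mulr0 mul1r subr0 dvdp0.
by rewrite !big_cons; apply: log_derivM.
Qed.

(** [P - Q] satisfies the same linear relation. As [S] has no constant term, [n] times its
    coefficient of degree [n] is a combination of the lower ones, and [n] is invertible in
    [algC]. *)
Lemma log_deriv_unique P Q S : P`_0 = Q`_0 -> S`_0 = 0 ->
  log_deriv P S -> log_deriv Q S -> forall n, (n <= M)%N -> P`_n = Q`_n.
Proof.
move=> PQ0 S0 PS QS.
have {PS QS}: log_deriv (P - Q) S.
  rewrite /log_deriv.
  have -> : 'X * (P - Q)^`() - (P - Q) * S =
    ('X * P^`() - P * S) - ('X * Q^`() - Q * S) by rewrite derivB; ring.
  by rewrite dvdp_sub.
move/dvdXnP => H n; have [k] := ubnP n; elim: k n => // k IH n /ltnSE nk nM.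
apply/eqP; rewrite -subr_eq0 -coefB.
case: n nk nM => [|n] nk nM; first by rewrite coefB PQ0 subrr.
have := H n.+1 nM; rewrite [in X in X -> _]coefB coefXM /= coef_deriv coefM big_ord_recr /=.
rewrite subnn S0 mulr0 addr0 big1 ?subr0 => [/eqP|i _]; first by rewrite mulrn_eq0.
rewrite coefB IH ?subrr ?mul0r //.
  by have := ltn_ord i; lia.
by have := ltn_ord i; lia.
Qed.

End NewtonSeries.

Section Newton.
Variables (F : finFieldType) (L : fieldExtType F) (M : nat) (rs : nat -> seq L).
Local Notation q := #|F|.
Local Notation inL := (GRing.in_alg L).
Hypothesis rsP : forall k, (0 < k <= M)%N ->
  \prod_(r <- rs k) ('X - r%:P) = 'X^(q ^ k) - 'X.
Hypothesis monP : forall n (v : 'rV[F]_n), (n <= M)%N ->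
  exists s : seq L, map_poly inL (mon v) = \prod_(z <- s) ('X - z%:P).

Lemma q_gt1 : (1 < q)%N. Proof. exact: finNzRing_gt1. Qed.

(** In this range [rs k] lists the subfield of [L] with [q ^ k] elements, the fixed field of the
    [k]-th Frobenius iterate. *)
Lemma mem_rs k r : (0 < k <= M)%N -> (r \in rs k) = (iter k frob r == r).
Proof.
move=> kM; rewrite -root_prod_XsubC rsP // rootE !hornerE iter_frobE subr_eq0.
by [].
Qed.

Lemma uniq_rs k : (0 < k <= M)%N -> uniq (rs k).
Proof.
move=> kM; rewrite -separable_prod_XsubC rsP // unlock derivB derivXn derivX -scaler_nat.
have -> : (q ^ k)%:R = 0 :> L.
  have [p p_pr pF] := finPcharP F.
  have pL : p \in [pchar L] by rewrite (rmorph_pchar inL).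
  have pq : (p %| q)%N.
    rewrite [q](card_pprimeChar pF) dvdn_exp //.
    have := q_gt1; rewrite [X in (1 < X)%N](card_pprimeChar pF).
    by case: logn.
  have /dvdnP[c ->] : (p %| q ^ k)%N by rewrite dvdn_exp //; case/andP: kM.
  by rewrite natrM (pcharf0 pL) mulr0.
by rewrite scale0r sub0r -[X in coprimep _ X]scaleN1r coprimepZr ?coprimep1 // oppr_eq0 oner_eq0.
Qed.

(** By [mult_count] each root [z] contributes as many [k] as its multiplicity, and the
    multiplicities add up to the degree. *)
Lemma count_total n (v : 'rV[F]_n) : (n <= M)%N ->
  (\sum_(1 <= k < n.+1) \sum_(r <- rs k | (dcpoly r k %| mon v)%R) 1)%N = n.
Proof.
move=> nM; have [s es] := monP v nM.
have ss : size s = n.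
  by apply/eqP; rewrite -eqSS -(size_prod_XsubC s id) -es size_map_poly size_mon.
transitivity (\sum_(1 <= k < n.+1) \sum_(z <- undup s |
     (iter k frob z == z) && (cpoly z k %| \prod_(x <- s) ('X - x%:P))%R) 1)%N.
  rewrite !big_nat; apply: eq_bigr => k /andP[k0 kn].
  have kM : (0 < k <= M)%N by rewrite k0; lia.
  rewrite -big_filter -[RHS]big_filter; apply: perm_big; apply: uniq_perm.
  - by rewrite filter_uniq ?uniq_rs.
  - by rewrite filter_uniq ?undup_uniq.
  move=> z; rewrite !mem_filter mem_rs // mem_undup -es.
  case: eqP => [zk|]; last by rewrite !andbF.
  rewrite andbT /= -dcpolyE // dvdp_map; case: (boolP (_ %| _)) => //= dv.
  rewrite -root_prod_XsubC -es -dvdp_XsubCl.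
  move: dv; rewrite -(dvdp_map inL) dcpolyE // => dv; symmetry; apply: dvdp_trans dv.
  by case: k k0 {kn kM zk} => // k _; rewrite cpolyS dvdp_mulr.
rewrite (exchange_big_dep xpredT) //= -[RHS]ss.
under eq_bigr => z _.
  rewrite mult_count ?ss //; last by rewrite -es map_frob_in_alg.
  over.
rewrite -[in RHS](perm_size (perm_count_undup s)) size_flatten /shape -map_comp sumnE big_map.
by apply: eq_bigr => z _ /=; rewrite size_nseq.
Qed.

Variable lam : {poly F} -> algC.
Hypothesis lamM :
  forall f g, f \is monic -> g \is monic -> lam (f * g) = lam f * lam g.

Definition csum n := \sum_(v : 'rV[F]_n) lam (mon v).
Definition ssum k := \sum_(r <- rs k) lam (dcpoly r k).

(** The factor [n] is replaced, polynomial by polynomial, by the count of [count_total]; after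
    exchanging the sums, [sum_mon_dvd] evaluates each sum over multiples. *)
Lemma newton n : (n <= M)%N ->
  n%:R * csum n = \sum_(1 <= k < n.+1) ssum k * csum (n - k).
Proof.
move=> nM; rewrite mulr_sumr.
transitivity (\sum_(v : 'rV[F]_n) \sum_(1 <= k < n.+1)
   \sum_(r <- rs k | dcpoly r k %| mon v) lam (mon v)).
  apply: eq_bigr => v _; rewrite -{1}(count_total v nM) natr_sum mulr_suml.
  apply: eq_bigr => k _; rewrite natr_sum mulr_suml.
  by apply: eq_bigr => r _; rewrite mul1r.
rewrite exchange_big /= !big_nat; apply: eq_bigr => k /andP[k0 kn].
have kM : (0 < k <= M)%N by rewrite k0; lia.
under eq_bigr => v _ do rewrite big_mkcond.
rewrite exchange_big /= mulr_suml !big_seq; apply: eq_bigr => r.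
rewrite mem_rs // => /eqP rk; rewrite -big_mkcond /=.
by rewrite (sum_mon_dvd (dcpoly_monic rk) (size_dcpoly rk)) //; lia.
Qed.

Lemma csum_log_deriv : log_deriv M (\poly_(n < M.+1) csum n)
  (\poly_(k < M.+1) (if k == 0%N then 0 else ssum k)).
Proof.
apply/dvdXnP => n nM; rewrite coefB coefXM; apply/eqP; rewrite subr_eq0; apply/eqP.
have -> : (if n == 0%N then 0 else (\poly_(n < M.+1) csum n)^`()`_n.-1) = n%:R * csum n.
  case: n nM => [|n] nM /=; first by rewrite mul0r.
  by rewrite coef_deriv coef_poly nM mulr_natl.
rewrite newton // mulrC coefM -(big_mkord xpredT (fun i => (\poly_(k < M.+1) (if k == 0%N then 0 else ssum k))`_i * (\poly_(n0 < M.+1) csum n0)`_(n - i))).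
rewrite [RHS]big_ltn // coef_poly /= mul0r add0r !big_nat.
apply: eq_bigr => k /andP[k0 kn]; rewrite !coef_poly.
by rewrite (leq_trans kn nM) (gtn_eqF k0) (leq_ltn_trans (leq_subr k n) nM).
Qed.

End Newton.

(** * The Hasse-Davenport product formula *)

Section HasseDavenport.
Variables (F : finFieldType) (th : F -> algC).
Hypothesis thP : additive_char th.
Local Notation q := #|F|.
Implicit Types (A B psi : 'CF(UG F)).

Definition lam A m (f : {poly F}) : algC := cext A (snorm f) * th (psum f m).

Lemma lamM A m f g : A \is a linear_char -> f \is monic -> g \is monic ->
  lam A m (f * g) = lam A m f * lam A m g.
Proof.
by move=> lA fm gm; rewrite /lam snormM // psumM // cextM // (thD thP) mulrACA.
Qed.

Lemma lam1 A m : A \is a linear_char -> lam A m 1 = 1.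
Proof. by move=> lA; rewrite /lam snorm1 psum1 cext1 // (th0 thP) mulr1. Qed.

Lemma csum0 A m : A \is a linear_char -> csum (lam A m) 0 = 1.
Proof.
move=> lA; rewrite /csum (big_pred1 0) => [|v]; last by rewrite [v]thinmx0 inE eqxx.
by rewrite /mon raddf0 addr0 expr0 lam1.
Qed.

Lemma coef_mon n (v : 'rV[F]_n) (i : 'I_n) : (mon v)`_i = v 0 i.
Proof. by rewrite /mon coefD coefXn ltn_eqF // add0r coef_rVpoly_ord. Qed.

Lemma psum_mon1 n (v : 'rV[F]_n.+1) : psum (mon v) 1 = - v 0 ord_max.
Proof.
rewrite /psum /= size_mon /= coefB coefXM coefZ !coef_deriv.
have -> : (mon v)`_n.+1 = 1.
  by have := monicP (mon_monic v); rewrite lead_coefE size_mon.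
have -> : (mon v)`_n = v 0 ord_max by rewrite -(coef_mon v ord_max).
case: n v => [|n] v /=; first by rewrite mulr1n mul1r sub0r.
have -> : (mon v)`_n.+1 = v 0 ord_max by rewrite -(coef_mon v ord_max).
by rewrite mulr_natl [in X in _ - X]mulrS opprD addrCA subrr addr0.
Qed.

Lemma snorm_mon n (v : 'rV[F]_n.+1) : snorm (mon v) = (-1) ^+ n.+1 * v 0 0.
Proof. by rewrite /snorm size_mon -(coef_mon v 0). Qed.

Lemma csum1 A : csum (lam A 1) 1 = gauss th A.
Proof.
rewrite /csum /gauss (reindex (fun x : F => (- x)%:M : 'rV[F]_1)) /=; last first.
  exists (fun v : 'rV_1 => - v 0 0) => [x _|v _]; first by rewrite mxE eqxx mulr1n opprK.
  by apply/rowP => i; rewrite mxE !ord1 eqxx mulr1n opprK.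
apply: eq_bigr => x _; rewrite /lam snorm_mon psum_mon1 (ord1 ord_max) !mxE.
by rewrite eqxx expr1 mulN1r !mulr1n !opprK.
Qed.

Lemma sum_shift0 (I : finType) (f : I -> algC) (s : I -> I) c :
  injective s -> (forall i, f (s i) = c * f i) -> c != 1 -> \sum_i f i = 0.
Proof.
move=> inj fs c1; apply/eqP; have : (1 - c) * (\sum_i f i) == 0.
  rewrite mulrBl mul1r subr_eq0 mulr_sumr [X in X == _](reindex_inj inj) /=.
  by apply/eqP/eq_bigr => i _; rewrite fs.
by rewrite mulf_eq0 subr_eq0 eq_sym (negPf c1).
Qed.

(** From degree two on, the subleading coefficient can be shifted without touching the constant one;
    this multiplies the sum by [th c], which is not 1. *)
Lemma csum_eq0 A n : csum (lam A 1) n.+2 = 0.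
Proof.
case: (thP) => _ _ [c c1].
apply: (@sum_shift0 _ _ (fun v => v - c *: delta_mx 0 ord_max) (th c)) c1 => [u v /addIr //|v].
rewrite /lam !snorm_mon !psum_mon1 !mxE !eqxx /= mulr0 subr0 mulr1 opprB.
by rewrite (thD thP) mulrCA.
Qed.

Lemma mon_addC n (v : 'rV[F]_n.+1) c : mon (v + c *: delta_mx 0 0) = mon v + c%:P.
Proof.
rewrite /mon raddfD /= linearZ /= -addrA rVpoly_delta.
by rewrite expr0 alg_polyC.
Qed.

(** The contribution of the non-constant coefficients; no multiplicative character enters. *)
Definition hd_const m := \sum_(v : 'rV[F]_m.+1 | v 0 0 == 0) th (psum (mon v) m.+1).

(** After sorting by the constant coefficient [x], [psum_addC] splits off [th (- (m.+1%:R * x))],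
    and the sum over [x] is a scaled Gauss sum. *)
Lemma csum_top B m : B \is a linear_char -> m.+1%:R != 0 :> F ->
  csum (lam B m.+1) m.+1 = cext B ((-1) ^+ m / m.+1%:R) * gauss th B * hd_const m.
Proof.
move=> lB m0.
have H x : \sum_(v : 'rV[F]_m.+1 | v 0 0 == x) th (psum (mon v) m.+1) =
    th (- (m.+1%:R * x)) * hd_const m.
  rewrite /hd_const (reindex (fun v : 'rV[F]_m.+1 => v + x *: delta_mx 0 0)) /=; last first.
    exists (fun v => v - x *: delta_mx 0 0) => v _; first by rewrite addrK.
    by rewrite subrK.
  rewrite mulr_sumr; apply: eq_big => [v|v _].
    by rewrite !mxE !eqxx mulr1 -subr_eq0 addrK.
  by rewrite mon_addC psum_addC ?mon_monic ?size_mon // (thD thP) mulrC.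
rewrite /csum (partition_big (fun v : 'rV[F]_m.+1 => v 0 0) xpredT) //=.
transitivity (\sum_x cext B ((-1) ^+ m.+1 * x) * th (- (m.+1%:R * x)) * hd_const m).
  apply: eq_bigr => x _; rewrite -mulrA -H mulr_sumr; apply: eq_bigr => v /eqP vx.
  by rewrite /lam snorm_mon vx.
rewrite -mulr_suml; congr (_ * _); rewrite /gauss mulr_sumr.
have nm : - m.+1%:R != 0 :> F by rewrite oppr_eq0.
rewrite [RHS](reindex_inj (mulfI nm)) /=; apply: eq_bigr => x _.
rewrite mulrA -cextM // mulNr; congr (cext _ _ * _).
by rewrite mulrN mulrA divfK // exprS mulN1r mulNr.
Qed.

End HasseDavenport.

(** * Kummer theory in the field with [q ^ k] elements *)

Section Kummer.
Variables (F : finFieldType) (L : fieldExtType F) (k m : nat) (rs : seq L).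
Local Notation q := #|F|.
Local Notation inL := (GRing.in_alg L).
Hypotheses (k0 : (0 < k)%N) (m0 : (0 < m)%N) (mq : (m %| q.-1)%N).
Hypothesis rsP : \prod_(r <- rs) ('X - r%:P) = 'X^(q ^ k) - 'X.
Hypothesis rsU : uniq rs.

Let mem_rs r : (r \in rs) = (r ^+ (q ^ k) == r).
Proof. by rewrite -root_prod_XsubC rsP rootE !hornerE subr_eq0. Qed.

Let rs_frob r : r \in rs -> iter k frob r = r.
Proof. by rewrite mem_rs iter_frobE => /eqP. Qed.

Lemma prod_traject (r : L) : \prod_(x <- traject frob r k) x = r ^+ (\sum_(i < k) q ^ i)%N.
Proof.
rewrite (big_nth r) size_traject big_mkord expr_sum; apply: eq_bigr => i _.
by rewrite nth_traject // iter_frobE.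
Qed.

Lemma in_alg_fnorm r : r \in rs -> inL (fnorm k r) = r ^+ (\sum_(i < k) q ^ i)%N.
Proof.
move/rs_frob => rr; rewrite -prod_traject -snorm_dcpoly //.
by rewrite -[LHS]snorm_map dcpolyE // snorm_prod_XsubC.
Qed.

Let rsX r n : r \in rs -> r ^+ n \in rs.
Proof. by rewrite !mem_rs => /eqP e; rewrite exprAC e. Qed.

Lemma fnormX r n : r \in rs -> fnorm k (r ^+ n) = fnorm k r ^+ n.
Proof.
move=> rr; apply: (fmorph_inj inL).
rewrite rmorphXn [LHS]in_alg_fnorm ?rsX // exprAC; congr (_ ^+ n).
exact/esym/in_alg_fnorm.
Qed.

Lemma fnorm0 : fnorm k (0 : L) = 0.
Proof.
apply: (fmorph_inj inL); rewrite rmorph0 [LHS]in_alg_fnorm.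
  rewrite expr0n (_ : _ == 0%N = false) //; case: k k0 => // n _.
  by rewrite big_ord_recl expn0.
by rewrite mem_rs expr0n expn_eq0 -[#|F| == 0%N]negbK -lt0n (ltnW (finNzRing_gt1 F)) eqxx.
Qed.

Lemma fnorm_neq0 r : r \in rs -> r != 0 -> fnorm k r != 0.
Proof.
by move=> rr r0; rewrite -(fmorph_eq0 inL) [X in X != _]in_alg_fnorm // expf_neq0.
Qed.

(** Euler's criterion for [m]-th powers: [r] has no [m]-th root or [m] distinct ones, and its norm
    decides, being the power of [r] with exponent [(q^k - 1)/(q - 1)]. *)
Lemma count_roots r : r \in rs -> r != 0 ->
  count (fun b => b ^+ m == r) rs =
    if fnorm k r ^+ (q.-1 %/ m) == 1 then m else 0%N.
Proof.
move=> rr r0.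
have -> : (fnorm k r ^+ (q.-1 %/ m) == 1) = (r ^+ ((q ^ k).-1 %/ m) == 1).
  rewrite -(inj_eq (fmorph_inj inL)) rmorphXn rmorph1 [X in X ^+ _]in_alg_fnorm //.
  by rewrite -exprM predn_exp mulnC -divn_mulAC.
have mE : (m * ((q ^ k).-1 %/ m) = (q ^ k).-1)%N.
  by rewrite mulnC divnK // predn_exp dvdn_mulr.
have qk0 : (0 < q ^ k)%N by rewrite expn_gt0 (ltnW (finNzRing_gt1 F)).
case: eqP => [rE|rE]; last first.
  apply/eqP; rewrite -leqn0 leqNgt -has_count; apply/negP => /hasP[b br /eqP bm].
  apply: rE; rewrite -bm -exprM mE.
  have b0 : b != 0 by apply: contraNneq r0 => b0; rewrite -bm b0 expr0n gtn_eqF.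
  by apply: (mulfI b0); rewrite -exprS prednK // mulr1; apply/eqP; rewrite -mem_rs.
(* With [e = (q ^ k).-1 %/ m] and [r ^+ e = 1], ['X^m - r%:P] divides ['X^(m * e) - 1]; hence it
   splits over [rs] with simple roots. *)
have dv : ('X^m - r%:P) %| \prod_(r <- rs) ('X - r%:P).
  have -> : \prod_(r <- rs) ('X - r%:P) = 'X * ('X^((q ^ k).-1) - 1).
    by rewrite rsP mulrBr mulr1 -exprS prednK.
  rewrite dvdp_mull //.
  by rewrite -mE exprM -[1](rmorph1 (@polyC L)) -rE rmorphXn /= subrXX dvdp_mulr.
have [b] := dvdp_prod_XsubC dv.
rewrite eqp_monic ?monicXnsubC ?monic_prod_XsubC // => /eqP eb.
have sm : size (mask b rs) = m.
  by apply/eqP; rewrite -eqSS -(size_prod_XsubC _ id) -eb size_XnsubC.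
rewrite -[RHS]sm -size_filter; apply/perm_size/uniq_perm; rewrite ?filter_uniq ?mask_uniq //.
move=> x; rewrite mem_filter.
have -> : (x \in mask b rs) = (x ^+ m == r).
  by rewrite -root_prod_XsubC -eb rootE !hornerE subr_eq0.
apply/andP/idP => [[]//|/eqP xm]; split; first exact/eqP.
rewrite -root_prod_XsubC -dvdp_XsubCl; apply: dvdp_trans dv.
by rewrite dvdp_XsubCl rootE !hornerE xm subrr.
Qed.

Variable psi : 'CF(UG F).
Hypothesis psiL : psi \is a linear_char.
Hypothesis psiK : forall c : F, c != 0 -> (cext psi c == 1) = (c ^+ (q.-1 %/ m) == 1).

(** [psi c] is an [m]-th root of unity, so the geometric sum vanishes unless it is 1. *)
Lemma sum_psi c : c != 0 ->
  \sum_(j < m) cext (psi ^+ j) c = if c ^+ (q.-1 %/ m) == 1 then m%:R else 0.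
Proof.
move=> c0; under eq_bigr => j _ do rewrite cextXl //.
rewrite -psiK //; case: eqP => [->|/eqP p1].
  by under eq_bigr => j _ do rewrite expr1n; rewrite sumr_const card_ord.
have /eqP : cext psi c ^+ m - 1 = 0.
  rewrite -cextX //; apply/eqP; rewrite subr_eq0 psiK ?expf_neq0 //.
  rewrite -exprM mulnC divnK // -(inj_eq (mulfI c0)) -exprS prednK ?(ltnW (finNzRing_gt1 F)) //.
  by rewrite expf_card mulr1.
by rewrite subrX1 mulf_eq0 subr_eq0 (negPf p1) => /eqP.
Qed.

Variable th : F -> algC.
Variable A : 'CF(UG F).
Hypothesis AL : A \is a linear_char.

(* Both sides are sums over [a] in [rs] weighted by the number of m-th roots of [a] in [rs]. *)
Lemma kummer :
  \sum_(r <- rs) lam th (A ^+ m) m (dcpoly r k) =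
  \sum_(j < m) \sum_(r <- rs) lam th (A * psi ^+ j) 1 (dcpoly r k).
Proof.
pose f (r : L) := cext A (fnorm k r) * th (ftrace k r).
have lE B n r : r \in rs -> lam th B n (dcpoly r k) = cext B (fnorm k r) * th (ftrace k (r ^+ n)).
  by move=> /rs_frob rr; rewrite /lam snorm_dcpoly // psum_dcpoly.
transitivity (\sum_(r <- rs) f (r ^+ m)).
  rewrite !big_seq; apply: eq_bigr => r rr; rewrite lE // /f fnormX // cextX //.
  have [->|r0] := eqVneq r 0; first by rewrite fnorm0 !cext0 mul0r (expr0n algC) gtn_eqF ?mul0r.
  by rewrite cextXl ?fnorm_neq0.
rewrite exchange_big /=.
transitivity (\sum_(a <- rs) \sum_(b <- rs | b ^+ m == a) f a).
  rewrite (exchange_big_dep xpredT) //= !big_seq; apply: eq_bigr => b br.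
  under eq_bigl => a do rewrite eq_sym.
  by rewrite -big_filter filter_pred1_uniq ?rsX // big_seq1.
rewrite !big_seq; apply: eq_bigr => a ar.
rewrite big_const_seq iter_addr_0 -mulr_natr.
have -> : \sum_(j < m) lam th (A * psi ^+ j) 1 (dcpoly a k) =
   f a * \sum_(j < m) cext (psi ^+ j) (fnorm k a).
  rewrite mulr_sumr; apply: eq_bigr => j _; rewrite lE // cextMl expr1 /f; ring.
have [->|a0] := eqVneq a 0; first by rewrite /f fnorm0 cext0 !mul0r.
by rewrite sum_psi ?fnorm_neq0 // count_roots //; case: ifP.
Qed.

End Kummer.

(** Only finitely many polynomials are concerned, so a splitting field of their product serves for
    all. *)
Lemma splitting_tower (F : finFieldType) M :
  exists (L : fieldExtType F) (rs : nat -> seq L),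
    (forall k, (0 < k <= M)%N -> \prod_(r <- rs k) ('X - r%:P) = 'X^(#|F| ^ k) - 'X) /\
    (forall n (v : 'rV[F]_n), (n <= M)%N -> exists s : seq L,
       map_poly (GRing.in_alg L) (mon v) = \prod_(z <- s) ('X - z%:P)).
Proof.
pose p1 : {poly F} := \prod_(k < M.+1) ('X^(#|F| ^ k.+1) - 'X).
pose p2 : {poly F} := \prod_(n < M.+1) \prod_(v : 'rV[F]_n) mon v.
have q1 := finNzRing_gt1 F.
have mon1 k : (0 < k)%N -> 'X^(#|F| ^ k) - 'X \is @monic F.
  move=> k0; rewrite monicE lead_coefDl ?lead_coefXn // size_polyN size_polyX size_polyXn.
  by rewrite ltnS (leq_trans q1) // -{1}(expn1 #|F|) leq_exp2l.
have p0 : p1 * p2 != 0.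
  rewrite mulf_neq0 //; apply/prodf_neq0 => i _; first by rewrite monic_neq0 ?mon1.
  by apply/prodf_neq0 => v _; rewrite monic_neq0 ?mon_monic.
have [L [s ps _]] := FinSplittingFieldFor p0.
have split (f : {poly F}) : f \is monic -> f %| p1 * p2 ->
    {t : seq L | map_poly (GRing.in_alg L) f = \prod_(z <- t) ('X - z%:P)}.
  move=> fm; rewrite -(dvdp_map (GRing.in_alg L)) (eqp_dvdr _ ps) => /dvdp_prod_XsubC[b].
  rewrite eqp_monic ?map_monic ?monic_prod_XsubC // => /eqP e.
  by exists (mask b s).
have mapE k : map_poly (GRing.in_alg L) ('X^(#|F| ^ k) - 'X) = 'X^(#|F| ^ k) - 'X.
  by rewrite rmorphB /= map_polyXn map_polyX.
have rsE k : {t : seq L | (0 < k <= M)%N -> \prod_(r <- t) ('X - r%:P) = 'X^(#|F| ^ k) - 'X}.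
  case: (boolP (0 < k <= M)%N) => [kM|]; last by exists [::].
  case/andP: kM => k0 kM.
  have [|t e] := split _ (mon1 _ k0); last by exists t => _; rewrite -e mapE.
  have lt : (k.-1 < M.+1)%N by lia.
  rewrite dvdp_mulr // /p1 (bigD1 (Ordinal lt)) //= prednK //.
  by rewrite dvdp_mulr.
exists L, (fun k => sval (rsE k)); split=> [k|n v nM]; first exact: (svalP (rsE k)).
have [|t e] := split _ (mon_monic v); last by exists t.
have lt : (n < M.+1)%N by [].
rewrite dvdp_mull // /p2 (bigD1 (Ordinal lt)) //= dvdp_mulr // (bigD1 v) //=.
by rewrite dvdp_mulr.
Qed.

(** * The product formula for Gauss sums *)

Section Product.
Variables (F : finFieldType) (th : F -> algC).
Hypothesis thP : additive_char th.
Variables (m : nat) (psi : 'CF(UG F)).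
Hypotheses (m0 : (0 < m)%N) (mq : (m %| #|F|.-1)%N).
Hypothesis psiL : psi \is a linear_char.
Hypothesis psiK :
  forall c : F, c != 0 -> (cext psi c == 1) = (c ^+ (#|F|.-1 %/ m) == 1).

Lemma prod_gauss_csum A : A \is a linear_char ->
  \prod_(j < m) gauss th (A * psi ^+ j) = csum (lam th (A ^+ m) m) m.
Proof.
move=> lA; have [L [rs [rsP sP]]] := splitting_tower F m.
have rsU k : (0 < k <= m)%N -> uniq (rs k) by apply: uniq_rs.
have lj (j : nat) : A * psi ^+ j \is a linear_char by rewrite mul_lin_char ?exp_lin_char.
have lAm := exp_lin_char m lA.
pose P (j : 'I_m) := \poly_(n < m.+1) csum (lam th (A * psi ^+ j) 1) n.
pose S (j : 'I_m) := \poly_(k < m.+1)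
   (if k == 0%N then 0 else ssum rs (lam th (A * psi ^+ j) 1) k).
have PS j : log_deriv m (P j) (S j).
  by apply: (csum_log_deriv rsP sP) => f g; apply: lamM.
have := log_deriv_prod (index_enum 'I_m) PS.
have QS := csum_log_deriv rsP sP (fun f g => lamM thP m lAm (f := f) (g := g)).
(* Degrees 0 and 1 give [1] and the Gauss sum, and [csum_eq0] removes the rest, so each factor is
   linear. *)
have PE j : P j = 1 + gauss th (A * psi ^+ j) *: 'X.
  apply/polyP => i; rewrite coef_poly coefD coefZ coefX coef1.
  case: i => [|[|i]] /=; rewrite ?mulr0 ?addr0 ?mulr1 ?add0r.
  - exact: csum0.
  - by rewrite ltnS m0 csum1.
  - by rewrite csum_eq0 // if_same.
have -> : \sum_(j <- index_enum 'I_m) S j = \poly_(k < m.+1)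
   (if k == 0%N then 0 else ssum rs (lam th (A ^+ m) m) k).
  apply/polyP => i; rewrite coef_sum coef_poly.
  under eq_bigr => j _ do rewrite coef_poly.
  case: ifP => im; last by rewrite big1.
  case: eqP => [_|/eqP i0]; first by rewrite big1.
  have im' : (0 < i <= m)%N by rewrite lt0n i0.
  rewrite /ssum; case/andP: (im') => ? ?.
  by rewrite (kummer _ m0 mq (rsP _ im') (rsU _ im') psiL psiK).
move=> PQ; have := log_deriv_unique _ _ PQ QS (leqnn m).
rewrite !coef_poly /= ltnSn => <- //; last first.
  rewrite -horner_coef0 horner_prod big1 ?csum0 // => j _.
  by rewrite PE !hornerE ?mulr0 ?addr0.
rewrite (eq_bigr _ (fun j _ => PE j)).
suff H (r : seq 'I_m) : (\prod_(j <- r) (1 + gauss th (A * psi ^+ j) *: 'X))`_(size r)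
    = \prod_(j <- r) gauss th (A * psi ^+ j).
  by rewrite -H; congr (_`_ _); rewrite /index_enum -enumT size_enum_ord.
(* The size bound is carried along so that the product of the earlier factors has no coefficient one
   degree higher. *)
suff : (size (\prod_(j <- r) (1 + gauss th (A * psi ^+ j) *: 'X))%R <= (size r).+1)%N
   /\ (\prod_(j <- r) (1 + gauss th (A * psi ^+ j) *: 'X))`_(size r)
    = \prod_(j <- r) gauss th (A * psi ^+ j) by case.
elim: r => [|j r [IH1 IH2]]; first by rewrite !big_nil size_poly1 coef1.
rewrite !big_cons mulrDl mul1r -scalerAl.
split; last first.
  by rewrite coefD coefZ coefXM /= IH2 nth_default // add0r.
apply: leq_trans (size_polyD _ _) _; rewrite geq_max (leq_trans IH1) //=.
apply: leq_trans (size_scale_leq _ _) _.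
by apply: leq_trans (size_polyMleq _ _) _; rewrite size_polyX.
Qed.

(** Otherwise both [q - 1] and [q] would be zero in [F]. *)
Lemma natr_dvd_card_neq0 : m%:R != 0 :> F.
Proof.
case/dvdnP: mq => c ec; apply/eqP => e.
have : (#|F|.-1)%:R = 0 :> F by rewrite ec natrM e mulr0.
have [p p_pr pF] := finPcharP F.
have : #|F|%:R = 0 :> F.
  have := q_gt1 F; rewrite [#|F|](card_pprimeChar pF); case: logn => // n _.
  by rewrite expnS natrM (pcharf0 pF) mul0r.
rewrite -{1}(prednK (ltnW (q_gt1 F))) -natr1 => + e2; rewrite e2 add0r.
by move/eqP; rewrite oner_eq0.
Qed.

(** The product is known up to [hd_const]; the case [A = 1], where the Gauss sum is [-1], evaluates
    that constant. *)
Theorem hasse_davenport A : A \is a linear_char ->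
  \prod_(j < m) gauss th (A * psi ^+ j) =
  - cext (A ^+ m) (m%:R^-1) * gauss th (A ^+ m) * \prod_(j < m) gauss th (psi ^+ j).
Proof.
move=> lA; have mF := natr_dvd_card_neq0.
have H B : B \is a linear_char -> \prod_(j < m) gauss th (B * psi ^+ j) =
    cext (B ^+ m) (m%:R^-1) * gauss th (B ^+ m) * hd_const th m.-1.
  move=> lB; rewrite prod_gauss_csum //; case: (m) m0 mF => // n _ nF /=.
  rewrite csum_top ?exp_lin_char //; congr (_ * _ * _).
  rewrite !cextXl ?invr_neq0 ?mulf_neq0 ?signr_eq0 ?invr_neq0 // -!cextX // exprMn.
  (* The sign disappears because [n * n.+1] is even. *)
  by rewrite -exprM -signr_odd oddM /= andbN mul1r.
have := H 1 (@one_lin_char F); rewrite expr1n gauss1 // cext_cfun1 invr_neq0 // mul1r.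
under eq_bigr => j _ do rewrite mul1r.
by move=> ->; rewrite H // mulN1r mulrN !mulNr opprK.
Qed.

End Product.

(** * Jacobi sums and the character sum over the curve *)

Section GaussSums.
Variables (F : finFieldType) (th : F -> algC).
Hypothesis thP : additive_char th.
Local Notation q := (#|F|%:R : algC).
Local Notation g := (gauss th).
Implicit Types (A B : 'CF(UG F)).

Lemma sum_cext A : A \is a linear_char ->
  \sum_x cext A x = if A == 1 then q - 1 else 0.
Proof.
move=> lA; case: eqVneq => [->|A1].
  under eq_bigr => x _ do rewrite cext_cfun1.
  rewrite (bigD1 0) //= eqxx add0r (eq_bigr (fun=> 1)) => [|x ->//].
  by rewrite sumr_const cardC1 -[in RHS](prednK (ltnW (q_gt1 F))) -natr1 addrK.
have [c c0 c1] := lin_char_nontrivial lA A1.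
apply: (@sum_shift0 _ _ (fun x => c * x) (cext A c)) c1 => [|x]; first exact: mulfI.
exact: cextM.
Qed.

Lemma q_neq0 : q != 0.
Proof. by rewrite pnatr_eq0 -lt0n (ltnW (q_gt1 F)). Qed.

Lemma q1_neq0 : q - 1 != 0.
Proof. by rewrite subr_eq0 (eqr_nat _ _ 1) gtn_eqF // q_gt1. Qed.

(** Substituting [x * y] for the variable of [g A] leaves sums of [th (y * (1 + x))] over [y != 0];
    completing them by [y = 0] isolates [x = -1] and costs the sum of [A]. *)
Lemma gauss_mulV A : A \is a linear_char ->
  g A * g A^-1 = if A == 1 then 1 else q * cext A (-1).
Proof.
move=> lA; have -> : g A * g A^-1 = q * cext A (-1) - \sum_x cext A x.
  rewrite mulrC {1}/gauss mulr_suml.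
  transitivity (\sum_(y | y != 0) \sum_x cext A x * th (y * (1 + x))).
    rewrite (bigD1 0) //= cext0 !mul0r add0r; apply: eq_bigr => y y0.
    rewrite cextVl // mulrAC -gauss_scale // mulr_suml.
    by apply: eq_bigr => x _; rewrite -mulrA -(thD thP) mulrDr mulr1 addrC.
  transitivity (\sum_x (cext A x * (if 1 + x == 0 then q else 0) - cext A x)).
    rewrite exchange_big /=; apply: eq_bigr => x _; rewrite -mulr_sumr.
    rewrite -(sum_thM thP) [\sum_x0 th _](bigD1 0) //= mulr0 (th0 thP) mulrDr mulr1.
    by rewrite [cext A x + _]addrC addrK; congr (_ * _); apply: eq_bigr => y _; rewrite mulrC.
  rewrite sumrB; congr (_ - _); rewrite (bigD1 (-1)) //= subrr eqxx mulrC big1 ?addr0 // => x x1.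
  by rewrite addrC addr_eq0 (negPf x1) mulr0.
rewrite sum_cext //; case: eqP => [->|_]; last by rewrite subr0.
by rewrite cext_cfun1 oppr_eq0 oner_eq0 mulr1 opprB addrC subrK.
Qed.

Lemma gauss_neq0 A : A \is a linear_char -> g A != 0.
Proof.
move=> lA; have := gauss_mulV lA; case: eqP => _ e; apply: contra_eq_neq e => ->.
  by rewrite mul0r eq_sym oner_eq0.
by rewrite mul0r eq_sym mulf_neq0 ?q_neq0 // cext_neq0 // oppr_eq0 oner_eq0.
Qed.

(** Sorted by [s = x + y], the terms with [s != 0] scale to the Jacobi sum; those with [s = 0] give
    the sum of a nontrivial character up to sign. *)
Lemma gaussM A B : A \is a linear_char -> B \is a linear_char -> A * B != 1 ->
  g A * g B = (\sum_x cext A x * cext B (1 - x)) * g (A * B).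
Proof.
move=> lA lB AB1; rewrite {1 2}/gauss mulr_suml.
transitivity (\sum_s \sum_x cext A x * cext B (s - x) * th s).
  rewrite exchange_big /=; apply: eq_bigr => x _; rewrite mulr_sumr.
  rewrite [RHS](reindex_inj (addIr x)) /=; apply: eq_bigr => y _.
  rewrite addrK (thD thP); ring.
rewrite (bigD1 0) //= [X in X + _](_ : _ = 0) ?add0r.
  rewrite [g (A * B)]/gauss [\sum_x cext (A * B) x * th x](bigD1 0) //= cext0 mul0r add0r mulr_sumr.
  apply: eq_bigr => s s0; rewrite -mulr_suml cextMl mulrA; congr (_ * _).
  rewrite (reindex_inj (mulfI s0)) /= mulr_suml; apply: eq_bigr => x _.
  have -> : s - s * x = s * (1 - x) by rewrite mulrBr mulr1.
  by rewrite !cextM // mulrACA mulrC.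
rewrite -mulr_suml (eq_bigr (fun x => cext B (-1) * cext (A * B) x)) => [|x _].
  by rewrite -mulr_sumr sum_cext ?mul_lin_char // (negPf AB1) mulr0 mul0r.
by rewrite sub0r -[- x]mulN1r cextM // cextMl; ring.
Qed.

Lemma cbinom_gauss A B : A \is a linear_char -> B \is a linear_char -> A * B^-1 != 1 ->
  cbinom A B = cext B (-1) / q * (g A * g B^-1 / g (A * B^-1)).
Proof.
move=> lA lB AB; rewrite gaussM ?inv_lin_char // mulfK //.
by rewrite gauss_neq0 // mul_lin_char ?inv_lin_char.
Qed.

Lemma chi_lin (i : Iirr (UG F)) : 'chi_i \is a linear_char.
Proof.
apply/char_abelianP: i; apply/centsP => u _ v _.
by apply/val_inj; rewrite /= mulrC.
Qed.

(** The sum of all characters of an abelian group is its regular character. *)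
Lemma sum_chi (x : F) : x != 0 -> \sum_(i : Iirr (UG F)) cext 'chi_i x = if x == 1 then q - 1 else 0.
Proof.
case/unit_valP => u <-.
under eq_bigr => i _ do rewrite cext_val.
have -> : \sum_i 'chi[UG F]_i u = cfReg (UG F) u.
  rewrite cfReg_sum sum_cfunE; apply: eq_bigr => i _.
  by rewrite cfunE lin_char1 ?chi_lin // mul1r.
rewrite cfRegE card_finField_unit (_ : (val u == 1) = (u == 1%g)) //.
case: eqP => _; rewrite ?mulr0n // mulr1n.
by rewrite -[in RHS](prednK (ltnW (q_gt1 F))) -natr1 addrK.
Qed.

(** Fourier inversion on the multiplicative group; it separates the variables in [point_sum]. *)
Lemma th_expand (w : F) : w != 0 ->
  th w = (q - 1)^-1 * \sum_(i : Iirr (UG F)) g ('chi_i)^-1 * cext 'chi_i w.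
Proof.
move=> w0; apply: (mulfI q1_neq0); rewrite mulrA divff ?q1_neq0 // mul1r.
transitivity (\sum_x th x * \sum_(i : Iirr (UG F)) cext 'chi_i (w * x^-1)).
  rewrite (bigD1 w) //= divff // sum_chi ?oner_eq0 // eqxx big1 ?addr0; first by rewrite mulrC.
  move=> x xw; have [->|x0] := eqVneq x 0.
    by rewrite invr0 mulr0 big1 ?mulr0 // => i _; rewrite cext0.
  rewrite sum_chi ?mulf_neq0 ?invr_neq0 // (_ : _ == 1 = false) ?mulr0 //.
  by apply: contraNF xw => /eqP e; rewrite -[w](divfK x0) e mul1r.
under eq_bigr => x _ do rewrite mulr_sumr.
rewrite exchange_big /=; apply: eq_bigr => i _; rewrite mulr_suml; apply: eq_bigr => x _.
rewrite cextM ?chi_lin // cextV ?chi_lin // cextVl ?chi_lin //; ring.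
Qed.

Section Quadratic.
Variable phi : 'CF(UG F).
Hypotheses (phiL : phi \is a linear_char) (phi2 : phi ^+ 2 = 1) (phi1 : phi != 1).

Lemma phi_sq x : x != 0 -> cext phi x ^+ 2 = 1.
Proof. by move=> x0; rewrite -cextXl // phi2 cext_cfun1 x0. Qed.

Lemma phiV : phi^-1 = phi.
Proof. by apply: (mulrI (lin_char_unitr phiL)); rewrite divrr ?lin_char_unitr // -expr2. Qed.

Lemma phi_gauss z : g phi * cext phi z = \sum_s cext phi s * th (z * s).
Proof.
have [->|z0] := eqVneq z 0.
  rewrite cext0 mulr0 (eq_bigr (cext phi)) => [|s _]; last by rewrite mul0r (th0 thP) mulr1.
  by rewrite sum_cext // (negPf phi1).
by rewrite gauss_scale // -cextVl // phiV mulrC.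
Qed.

Lemma point_sum d (a b : F) : odd d -> (1 < d)%N -> a != 0 -> b != 0 ->
  g phi * \sum_x cext phi (x ^+ d + a * x ^+ d.-1 + b) =
  g phi * cext phi b + cext phi a / (q - 1) *
    \sum_(i : Iirr (UG F)) g ('chi_i)^-1 * g (phi * 'chi_i ^+ d) *
       g (('chi_i)^-1 ^+ d.-1) * cext 'chi_i (b / a ^+ d).
Proof.
case: d => // d' /= od d1 a0 b0; set d := d'.+1.
rewrite mulr_sumr (bigD1 0) //=; congr (_ + _).
  by rewrite expr0n /= add0r expr0n gtn_eqF // mulr0 add0r.
(* [phi_gauss] makes the argument of [phi] additive; its variable is then replaced by
   [u / x ^+ d]. *)
transitivity (\sum_(x | x != 0) \sum_u cext phi (u * x^-1 ^+ d) * th u *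
    (th (u * a / x) * th (u * b * x^-1 ^+ d))).
  apply: eq_bigr => x x0; rewrite phi_gauss.
  have xd : x^-1 ^+ d != 0 by rewrite expf_neq0 ?invr_neq0.
  rewrite (reindex_inj (mulIf xd)) /=; apply: eq_bigr => u _.
  rewrite -mulrA -!(thD thP); congr (_ * th _).
  rewrite exprVn /d exprS; field.
  by rewrite x0 expf_neq0.
rewrite exchange_big /=.
transitivity (\sum_(u | u != 0) \sum_(v | v != 0) cext phi a * (cext phi v * th u * th v) *
    th (b / a ^+ d * v ^+ d / u ^+ d')).
  rewrite (bigD1 0) //= big1 ?add0r => [|x _]; last by rewrite mul0r cext0 !mul0r.
  apply: eq_bigr => u u0.
  have ua : u * a != 0 by rewrite mulf_neq0.
  have inj : injective (fun v => u * a / v) by move=> v w /(mulfI ua)/invr_inj.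
  (* For fixed [u], the variable [x] is replaced by [u * a / v]. *)
  rewrite (reindex_inj inj) /=; apply: eq_big => [v|v].
    by rewrite mulf_eq0 (negPf ua) invr_eq0.
  rewrite mulf_eq0 (negPf ua) invr_eq0 /= => v0.
  have -> : u * a / (u * a / v) = v by field; rewrite v0 u0 a0.
  have -> : u * b * (u * a / v)^-1 ^+ d = b / a ^+ d * v ^+ d / u ^+ d'.
    rewrite invf_div expr_div_n exprMn /d ![u ^+ _.+1]exprS; field.
    by rewrite u0 !expf_neq0.
  have -> : cext phi (u * (u * a / v)^-1 ^+ d) = cext phi a * cext phi v.
    (* Since [d] is odd, [phi] sees the [d]-th power as a first power, and the two factors [u]
       cancel. *)
    have od' : d = (d./2 * 2).+1 by rewrite muln2 -[LHS]odd_double_half /d /= od.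
    rewrite invf_div expr_div_n exprMn !cextM // cextV // cextM // !cextX // od' !exprS.
    rewrite mulnC !exprM !phi_sq // !expr1n !mulr1 invfM.
    have pV x : x != 0 -> (cext phi x)^-1 = cext phi x by move=> x0; rewrite -cextVl // phiV.
    rewrite !pV // mulrCA !mulrA -[_ * _ * cext phi u]mulrA -expr2 phi_sq // mulr1 mulrC.
    by [].
  ring.
(* Only the additive factor mixing [u] and [v] is expanded; what remains factors into Gauss sums. *)
have E u v : u != 0 -> v != 0 ->
    cext phi a * (cext phi v * th u * th v) * th (b / a ^+ d * v ^+ d / u ^+ d') =
    \sum_(i : Iirr (UG F)) cext phi a / (q - 1) * (g ('chi_i)^-1 * cext 'chi_i (b / a ^+ d)) *
      (cext (('chi_i)^-1 ^+ d') u * th u) * (cext (phi * 'chi_i ^+ d) v * th v).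
  move=> u0 v0; rewrite [X in _ * X = _]th_expand ?mulf_neq0 ?invr_neq0 ?expf_neq0 //.
  rewrite [LHS]mulrA mulr_sumr; apply: eq_bigr => i _.
  have li := chi_lin i.
  rewrite [in LHS]cextM // [in LHS]cextM // cextV // !cextX // cextMl !cextXl // cextVl //.
  rewrite exprVn; ring.
transitivity (\sum_(u | u != 0) \sum_(i : Iirr (UG F)) \sum_(v | v != 0)
    cext phi a / (q - 1) * (g ('chi_i)^-1 * cext 'chi_i (b / a ^+ d)) *
      (cext (('chi_i)^-1 ^+ d') u * th u) * (cext (phi * 'chi_i ^+ d) v * th v)).
  by apply: eq_bigr => u u0; rewrite exchange_big /=; apply: eq_bigr => v v0; apply: E.
rewrite exchange_big /= mulr_sumr; apply: eq_bigr => i _.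
under eq_bigr => u u0 do rewrite -mulr_sumr.
rewrite -mulr_suml -mulr_sumr.
have gE B : \sum_(u | u != 0) cext B u * th u = g B.
  by rewrite /gauss [RHS](bigD1 0) //= cext0 mul0r add0r.
rewrite !gE; ring.
Qed.

End Quadratic.

End GaussSums.

(** * Point count, paired products, and the generating character *)

Section PointCount.
Variable F : finFieldType.
Local Notation q := (#|F|%:R : algC).

Lemma card_sqrt (z : F) : 2%:R != 0 :> F ->
  #|[pred y : F | y ^+ 2 == z]|%:R = 1 + qchar z.
Proof.
move=> two; rewrite /qchar; case: eqVneq => [->|z0].
  rewrite (eq_card1 (x := 0)) ?addr0 // => y; rewrite !inE.
  by rewrite expf_eq0.
case: existsP => [[y0 /eqP e0]|no]; last first.
  rewrite eq_card0 ?addrN // => y; rewrite inE; apply/negP => yz; case: no.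
  by exists y.
have y00 : y0 != 0 by apply: contraNneq z0 => e; rewrite -e0 e expr0n.
rewrite (eq_card (B := pred2 y0 (- y0))) => [|y]; last by rewrite !inE -e0 eqf_sqr.
rewrite card2 (_ : y0 != - y0) //.
by rewrite -subr_eq0 opprK -mulr2n -mulr_natr mulf_neq0.
Qed.

Lemma Nd_sum d (a b : F) : 2%:R != 0 :> F ->
  (Nd d a b)%:R = q + \sum_x qchar (x ^+ d + a * x ^+ d.-1 + b).
Proof.
move=> two; rewrite /Nd -sum1_card.
rewrite (eq_bigl (fun p => xpredT p.1 && (p.2 ^+ 2 == p.1 ^+ d + a * p.1 ^+ d.-1 + b))).
  rewrite -(pair_big_dep xpredT (fun x y => y ^+ 2 == x ^+ d + a * x ^+ d.-1 + b) (fun _ _ => 1%N)).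
  rewrite /= natr_sum; under eq_bigr => x _ do rewrite sum1_card card_sqrt //.
  by rewrite big_split /= sumr_const.
by move=> p; rewrite inE.
Qed.

(** Euler's criterion: if [phi z = 1], then ['X^2 - z%:P] divides ['X^q - 'X] and so has a root in
    [F]. *)
Lemma qchar_cext (phi : 'CF(UG F)) z : (2 %| #|F|.-1)%N -> phi \is a linear_char ->
  phi ^+ 2 = 1 ->
  (forall c : F, c != 0 -> (cext phi c == 1) = (c ^+ (#|F|.-1 %/ 2) == 1)) ->
  qchar z = cext phi z.
Proof.
move=> dv lp p2 pK; rewrite /qchar; case: eqVneq => [->|z0]; first by rewrite cext0.
case: existsP => [[y /eqP e]|no].
  by rewrite -e cextX // phi_sq //; apply: contraNneq z0 => y0; rewrite -e y0 expr0n.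
have := phi_sq p2 z0; move/eqP; rewrite sqrf_eq1 => /orP[|/eqP->//].
rewrite pK // => /eqP ze; case: no.
have dvp : ('X^2 - z%:P) %| \prod_(x : F) ('X - x%:P).
  rewrite -finField_genPoly.
  have -> : 'X^#|F| - 'X = 'X * ('X^(#|F|.-1) - 1) :> {poly F}.
    by rewrite mulrBr mulr1 -exprS prednK // ltnW // q_gt1.
  rewrite dvdp_mull // -{1}(divnK dv) mulnC exprM -[1](rmorph1 (@polyC F)) -ze.
  by rewrite rmorphXn /= subrXX dvdp_mulr.
have [s] := dvdp_prod_XsubC dvp.
rewrite eqp_monic ?monicXnsubC ?monic_prod_XsubC // => /eqP es.
have /eqP : size (mask s (index_enum F)) = 2.
  by apply/eqP; rewrite -eqSS -(size_prod_XsubC _ id) -es size_XnsubC.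
case: (mask _ _) es => // y r es _; exists y.
have : root ('X^2 - z%:P) y by rewrite es root_prod_XsubC mem_head.
by rewrite rootE !hornerE subr_eq0.
Qed.

End PointCount.

Section PairedProducts.
Variables (R : comNzRingType) (f : nat -> R) (h : nat).

Lemma prod_upper_half : (0 < h)%N ->
  \prod_(h.+1 <= j < 2 * h) f j = \prod_(1 <= j < h) f (2 * h - j)%N.
Proof.
move=> h0; rewrite [RHS]big_nat_rev /= -[h.+1]add1n (_ : 2 * h = h + h)%N; last by lia.
rewrite big_addn addnK !big_nat; apply: eq_bigr => i /andP[i0 ih]; congr f; lia.
Qed.

Lemma prod_pairs_even : (0 < h)%N ->
  \prod_(j < 2 * h) f j = f 0%N * f h * \prod_(1 <= j < h) (f j * f (2 * h - j)%N).
Proof.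
move=> h0; rewrite -(big_mkord xpredT) big_ltn; last by lia.
rewrite (big_cat_nat (n := h)) //=; last by lia.
rewrite [X in _ * (_ * X)]big_ltn; last by lia.
rewrite prod_upper_half // big_split /= -!mulrA; congr (_ * _).
by rewrite mulrCA.
Qed.

(** The omitted index [h] is the fixed point of the reflection [j -> 2h - j], so the index set of
    the series consists of pairs. *)
Lemma prod_skip_middle : (0 < h)%N ->
  \prod_(j <- [seq j <- iota 1 (2 * h - 1) | j != h]) f j =
  \prod_(1 <= j < h) (f j * f (2 * h - j)%N).
Proof.
move=> h0; rewrite big_filter -[iota _ _]/(index_iota 1 (2 * h)).
rewrite (big_cat_nat (n := h)) //=; last by lia.
rewrite [X in _ * X]big_mkcond /= [X in _ * X]big_ltn; last by lia.
rewrite eqxx /= mul1r [RHS]big_split /= -prod_upper_half // big_mkcond /= !big_nat.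
congr (_ * _); apply: eq_bigr => j /andP[hj jh]; first by rewrite ltn_eqF.
by rewrite gtn_eqF.
Qed.

Lemma prod_pairs_odd :
  \prod_(j < 2 * h + 1) f j = f 0%N * \prod_(1 <= j < h.+1) (f j * f (2 * h + 1 - j)%N).
Proof.
rewrite -(big_mkord xpredT) big_ltn; last by lia.
rewrite (big_cat_nat (n := h.+1)) //=; last by lia.
rewrite big_split /=; congr (_ * (_ * _)).
rewrite [RHS]big_nat_rev /= -[h.+1 in LHS]add1n (_ : 2 * h + 1 = h.+1 + h)%N; last by lia.
rewrite big_addn addnK !big_nat; apply: eq_bigr => i /andP[i0 ih]; congr f; lia.
Qed.

End PairedProducts.

Section Generator.
Variables (F : finFieldType) (t : Iirr (UG F)).
Hypothesis Tgen : forall i : Iirr (UG F), exists k : nat, 'chi_i = 'chi_t ^+ k.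
Local Notation T := ('chi_t).
Local Notation n := (#|F|.-1).

Lemma card_unit_gt0 : (0 < n)%N.
Proof. by have := q_gt1 F; case: #|F| => [|[]]. Qed.

Lemma expf_n (c : F) : c != 0 -> c ^+ n = 1.
Proof.
move=> c0; apply: (mulfI c0); rewrite -exprS prednK ?(ltnW (q_gt1 F)) //.
by rewrite expf_card mulr1.
Qed.

(** If [T c = 1], every character is 1 at [c], and their sum is nonzero; orthogonality then forces
    [c = 1]. *)
Lemma T_faithful (c : F) : c != 0 -> cext T c = 1 -> c = 1.
Proof.
move=> c0 Tc; apply/eqP; have := sum_chi c0; case: eqP => // _ /eqP.
rewrite (eq_bigr (fun=> 1)) => [|i _]; last first.
  by have [k ->] := Tgen i; rewrite cextXl // Tc expr1n.
by rewrite sumr_const pnatr_eq0 => /eqP/card0_eq/(_ t).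
Qed.

(** Supplies the hypothesis [psiK] of the product formula. *)
Lemma T_kummer m (c : F) : c != 0 -> (cext (T ^+ (n %/ m)) c == 1) = (c ^+ (n %/ m) == 1).
Proof.
move=> c0; rewrite cextXl // -cextX ?chi_lin //.
apply/eqP/eqP => [|->]; last by rewrite cext1 ?chi_lin.
by apply: T_faithful; rewrite expf_neq0.
Qed.

Lemma T_n : T ^+ n = 1.
Proof.
apply: cext_inj => x x0; rewrite cextXl // -cextX ?chi_lin // expf_n //.
by rewrite cext1 ?chi_lin // cext_cfun1 x0.
Qed.

(** Otherwise there would be at most [k] irreducible characters, fewer than the group order. *)
Lemma T_order k : (0 < k < n)%N -> T ^+ k != 1.
Proof.
case/andP=> k0 kn; apply/eqP => Tk.
have sub : {subset irr (UG F) <= [seq T ^+ i | i <- iota 0 k]}.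
  move=> xi /irrP[i ->]; have [j ->] := Tgen i; apply/mapP; exists (j %% k)%N.
    by rewrite mem_iota ltn_mod.
  by rewrite {1}(divn_eq j k) exprD mulnC exprM Tk expr1n mul1r.
have := uniq_leq_size (free_uniq (irr_free (UG F))) sub.
rewrite size_map size_iota size_tuple -[Nirr _]card_ord card_Iirr_abelian; last first.
  by apply/centsP => u _ v _; apply/val_inj; rewrite /= mulrC.
by rewrite card_finField_unit leqNgt kn.
Qed.

End Generator.

(** * Coefficients of the hypergeometric series *)

(** The cancellation in [hyp_term]: [PF], [PK], [PD] are products over pairs of indices, and [fh],
    [kh] belong to the index that the series omits. *)
Lemma hyp_term_algebra (R : fieldType) (s q Q f0 fh f2h k0 kh PF PK PD e e' : R) :
  s * s = 1 -> q != 0 -> Q != 0 -> fh != 0 -> kh != 0 -> e != 0 -> e' != 0 -> PD != 0 ->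
  s / q * (f0 * k0 / e) * (1 / Q * (PF * PK / PD)) * (s / q * (f2h * k0 / e')) =
  (q * q * Q)^-1 * (f0 * fh * PF * f2h) * (k0 * kh * PK) * k0 / (fh * kh * (e * e' * PD)).
Proof.
move=> ss q0 Q0 fh0 kh0 e0 e'0 PD0.
transitivity (s * s * ((q * q * Q)^-1 * (f0 * fh * PF * f2h) * (k0 * kh * PK) * k0 /
    (fh * kh * (e * e' * PD)))); last by rewrite ss mul1r.
by field; rewrite q0 Q0 fh0 kh0 e0 e'0 PD0.
Qed.

Section Main.
Variables (F : finFieldType) (t : Iirr (UG F)) (th : F -> algC).
Hypothesis thP : additive_char th.
Hypothesis Tgen : forall i : Iirr (UG F), exists k : nat, 'chi_i = 'chi_t ^+ k.
Variables (h c : nat).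
Hypotheses (h0 : (0 < h)%N) (nE : (#|F|.-1 = 2 * h * (2 * h + 1) * c)%N).
Local Notation T := ('chi_t).
Local Notation q := (#|F|%:R : algC).
Local Notation g := (gauss th).
Local Notation d := (2 * h + 1)%N.

Let c0 : (0 < c)%N.
Proof. by have := card_unit_gt0 F; rewrite nE muln_gt0 => /andP[]. Qed.

(** As [q - 1 = 2hdc] with [d = 2h + 1], the exponents here and in the next two definitions are
    [(q - 1)/(2d)], [(q - 1)/(d - 1)] and [(q - 1)/2]. *)
Definition etaT := T ^+ (h * c).
Definition rhoT := T ^+ (d * c).
Definition phiT := T ^+ (h * d * c).
Local Notation eta := etaT.
Local Notation rho := rhoT.
Local Notation phi := phiT.

Let lT : T \is a linear_char := chi_lin t.
Let leta : eta \is a linear_char := exp_lin_char _ lT.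
Let lrho : rho \is a linear_char := exp_lin_char _ lT.
Let lphi : phi \is a linear_char := exp_lin_char _ lT.

Let Tn1 k : (k = #|F|.-1)%N -> T ^+ k = 1. Proof. by move->; exact: T_n. Qed.

Lemma eta_d : eta ^+ d = phi.
Proof. by rewrite -exprM; congr (_ ^+ _); lia. Qed.
Lemma rho_h : rho ^+ h = phi.
Proof. by rewrite -exprM; congr (_ ^+ _); lia. Qed.
Lemma phi_sqr : phi ^+ 2 = 1.
Proof. by rewrite -exprM; apply: Tn1; lia. Qed.
Lemma eta_2d : eta ^+ (2 * d) = 1.
Proof. by rewrite mulnC exprM eta_d phi_sqr. Qed.
Lemma rho_2h : rho ^+ (2 * h) = 1.
Proof. by rewrite mulnC exprM rho_h phi_sqr. Qed.

Let hdc : (0 < h * d * c)%N.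
Proof. by rewrite !muln_gt0 h0 c0 addn1. Qed.

Lemma phi_neq1 : phi != 1.
Proof. by apply: T_order => //; rewrite hdc nE; lia. Qed.
Lemma eta_neq1 : eta != 1.
Proof.
apply: T_order => //; rewrite nE muln_gt0 h0 c0 /=.
by rewrite ltn_pmul2r // -mulnA mulnC -mulnA ltn_Pmulr //; lia.
Qed.

Let m1 : (-1 : F) != 0. Proof. by rewrite oppr_eq0 oner_eq0. Qed.

Lemma sgn_sq (A : 'CF(UG F)) : A \is a linear_char -> cext A (-1) ^+ 2 = 1.
Proof. by move=> lA; rewrite -cextX // sqrrN expr1n cext1. Qed.

Lemma sgnV (A : 'CF(UG F)) : A \is a linear_char -> (cext A (-1))^-1 = cext A (-1).
Proof.
move=> lA; apply: (mulfI (cext_neq0 lA m1)).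
by rewrite divff ?cext_neq0 // -expr2 sgn_sq.
Qed.

Lemma inv_of_mul (A B : 'CF(UG F)) : A \is a linear_char -> A * B = 1 -> A^-1 = B.
Proof.
move=> lA AB; apply: (mulrI (lin_char_unitr lA)).
by rewrite divrr ?lin_char_unitr // AB.
Qed.

Lemma gauss_pair (A B : 'CF(UG F)) : A \is a linear_char -> A * B = 1 -> A != 1 ->
  g A * g B = q * cext A (-1).
Proof.
by move=> lA AB A1; rewrite -(inv_of_mul lA AB) gauss_mulV // (negPf A1).
Qed.

Let dq : (d %| #|F|.-1)%N.
Proof. by rewrite nE -mulnA dvdn_mull // dvdn_mulr. Qed.
Let hq : (2 * h %| #|F|.-1)%N.
Proof. by rewrite nE -mulnA dvdn_mulr. Qed.

(** The product formula for [m = d]. Its constant comes from pairing [j] with [d - j]; each pair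
    gives [q], since [eta ^+ 2] is 1 at [-1]. *)
Lemma prod_gauss_eta A : A \is a linear_char ->
  \prod_(j < d) g (A * (eta ^+ 2) ^+ j) =
  q ^+ h * (cext (A ^+ d) (d%:R^-1) * g (A ^+ d)).
Proof.
move=> lA.
have e2 : eta ^+ 2 = T ^+ (#|F|.-1 %/ d).
  rewrite -exprM; congr (_ ^+ _); rewrite nE.
  by rewrite (_ : 2 * h * d * c = h * c * 2 * d)%N ?mulnK ?addn1 //; lia.
rewrite (hasse_davenport thP _ dq) ?exp_lin_char //; last first.
- by move=> x x0; rewrite e2 T_kummer.
- by rewrite addn1.
rewrite (prod_pairs_odd (fun j => g ((eta ^+ 2) ^+ j))) expr0 gauss1 //.
rewrite big_nat (eq_bigr (fun=> q)) -?big_nat => [|j /andP[j0 jh]].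
  by rewrite prodr_const_nat subSS subn0; ring.
rewrite gauss_pair ?exp_lin_char //.
- by rewrite cextXl // cextXl // sgn_sq // expr1n mulr1.
- rewrite -exprD subnKC; last by lia.
  by rewrite -exprM eta_2d.
rewrite -!exprM; apply: T_order => //; rewrite nE !muln_gt0 h0 c0 j0 /=.
have : (h * c * (2 * j) < h * c * (2 * d))%N.
  by rewrite ltn_pmul2l ?muln_gt0 ?h0 ?c0 //; lia.
by lia.
Qed.

(** This sign is left unevaluated, since it occurs again in [prod_gauss_sigma] and cancels. *)
Definition sgn_rho := \prod_(1 <= j < h) cext (rho ^+ j) (-1).

Lemma rho_neq1 j : (0 < j < 2 * h)%N -> rho ^+ j != 1.
Proof.
case/andP=> j0 jh; rewrite -exprM; apply: T_order => //.
rewrite nE !muln_gt0 c0 j0 addn1 /=.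
have : (d * c * j < d * c * (2 * h))%N by rewrite ltn_pmul2l // muln_gt0 c0 addn1.
by lia.
Qed.

(** The product formula for [m = 2h]; in the pairing of [j] with [2h - j] the middle index stays
    alone and gives [g phi]. *)
Lemma prod_gauss_rho A : A \is a linear_char ->
  \prod_(j < 2 * h) g (A * rho^-1 ^+ j) =
  q ^+ h.-1 * sgn_rho * g phi * (cext (A ^+ (2 * h)) ((2 * h)%:R^-1) * g (A ^+ (2 * h))).
Proof.
move=> lA; have lrV := inv_lin_char lrho.
have rE : rho = T ^+ (#|F|.-1 %/ (2 * h)).
  congr (_ ^+ _); rewrite nE -mulnA mulKn // muln_gt0; lia.
rewrite (hasse_davenport thP _ hq) //; last first.
- by move=> x x0; rewrite cextVl // invr_eq1 rE T_kummer.
- by lia.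
rewrite (prod_pairs_even (fun j => g (rho^-1 ^+ j))) // expr0 gauss1 //.
rewrite exprVn rho_h (phiV lphi phi_sqr).
rewrite big_nat (eq_bigr (fun j => q * cext (rho ^+ j) (-1))) -?big_nat => [|j /andP[j0 jh]].
  rewrite big_split /= prodr_const_nat subn1 /sgn_rho; ring.
have rj := exp_lin_char j lrho.
rewrite gauss_pair ?exp_lin_char //.
- by rewrite exprVn cextVl // sgnV.
- by rewrite -exprD subnKC ?exprVn ?rho_2h ?invr1 //; lia.
rewrite exprVn invr_eq1 rho_neq1 //; lia.
Qed.

(** The quotient of the upper by the lower parameter, whose Gauss sum is the denominator of a Jacobi
    sum. For [j <= 2h] it is trivial only at the omitted index [h]. *)
Definition sigma j := eta ^+ (2 * j + 1) * (rho ^+ j)^-1.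

Lemma sigma_lin j : sigma j \is a linear_char.
Proof. by rewrite mul_lin_char ?inv_lin_char ?exp_lin_char. Qed.

Lemma sigma_pair j : (j <= 2 * h)%N -> sigma j * sigma (2 * h - j) = 1.
Proof.
move=> jh; rewrite /sigma mulrACA -exprD -invrM ?lin_char_unitr ?exp_lin_char // -exprD.
rewrite subnK // rho_2h invr1 mulr1 (_ : _ + _ = 2 * d)%N ?eta_2d //; lia.
Qed.

Lemma sigma_neq1_low j : (j < h)%N -> sigma j != 1.
Proof.
move=> jh; have rj := exp_lin_char j lrho.
suff -> : sigma j = T ^+ (c * (h - j)).
  apply: T_order => //; rewrite muln_gt0 c0 subn_gt0 jh nE /=.
  rewrite mulnC ltn_pmul2r //; apply: (@leq_ltn_trans h); first exact: leq_subr.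
  by rewrite mulnC; nia.
apply: (mulIr (lin_char_unitr rj)); rewrite /sigma divrK ?lin_char_unitr // -!exprM -exprD.
by congr (_ ^+ _); nia.
Qed.

Lemma sigma_neq1 j : (j < 2 * h + 1)%N -> j != h -> sigma j != 1.
Proof.
move=> jd jh; have [lt|ge] := ltnP j h; first exact: sigma_neq1_low.
have le : (j <= 2 * h)%N by lia.
apply: contra (sigma_neq1_low (j := 2 * h - j) _) => [/eqP e|]; last by lia.
by have := sigma_pair le; rewrite e mul1r => /eqP.
Qed.

Lemma prod_gauss_sigma :
  g eta * g eta^-1 * \prod_(1 <= j < h) (g (sigma j) * g (sigma (2 * h - j))) =
  q ^+ h * sgn_rho * cext phi (-1).
Proof.
rewrite gauss_mulV // (negPf eta_neq1).
rewrite big_nat (eq_bigr (fun j => q * cext eta (-1) * cext (rho ^+ j) (-1))) -?big_nat; last first.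
  move=> j /andP[j0 jh]; rewrite gauss_pair ?sigma_lin ?sigma_pair ?sigma_neq1_low //; last by lia.
  rewrite /sigma cextMl cextVl ?exp_lin_char // cextXl // exprD exprM sgn_sq // expr1n mul1r expr1.
  by rewrite sgnV ?exp_lin_char // mulrA.
rewrite big_split /= prodr_const_nat subn1 -/sgn_rho.
have ep : cext eta (-1) = cext phi (-1).
  by rewrite -eta_d cextXl // exprD exprM sgn_sq // expr1n mul1r expr1.
(* Here [phi = rho ^+ h], and [h * h.-1] is even. *)
have eh : cext eta (-1) ^+ h.-1 = 1.
  rewrite ep -rho_h cextXl // -exprM.
  have : ~~ odd (h * h.-1) by rewrite oddM; case: (h) h0 => //= k _; rewrite andNb.
  by move/even_halfK => <-; rewrite -muln2 mulnC exprM sgn_sq // expr1n.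
rewrite exprMn eh mulr1 ep -{2}(prednK h0) exprS; ring.
Qed.

(** The product formulas need complete products, so the factors of the omitted index are inserted
    and divided out as [g (phi * chi) * g (phi * chi)^-1]. The last pair supplies the upper index
    [2h], and its lower parameter repeats [chi], whence the extra [g chi^-1]. *)
Lemma hyp_term (chi : 'CF(UG F)) : chi \is a linear_char ->
  cbinom (eta * chi) chi *
  \prod_(j <- [seq j <- iota 1 (2 * h - 1) | j != h])
     cbinom (eta ^+ (2 * j + 1) * chi) (rho ^+ j * chi) *
  cbinom (eta ^+ (2 * d - 1) * chi) (1 * chi) =
  q ^- (2 * h) * (\prod_(j < d) g (eta * chi * (eta ^+ 2) ^+ j)) *
   (\prod_(j < 2 * h) g (chi^-1 * rho^-1 ^+ j)) * g chi^-1 /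
   (g (phi * chi) * g (phi * chi)^-1 * (q ^+ h * sgn_rho * cext phi (-1))).
Proof.
move=> lchi.
pose f j := g (eta ^+ (2 * j + 1) * chi).
pose k j := g (rho ^+ j * chi)^-1.
pose s j := cext (rho ^+ j * chi) (-1).
pose D j := g (sigma j).
have lf j : eta ^+ (2 * j + 1) * chi \is a linear_char by rewrite mul_lin_char ?exp_lin_char.
have lk j : rho ^+ j * chi \is a linear_char by rewrite mul_lin_char ?exp_lin_char.
have quot j : (eta ^+ (2 * j + 1) * chi) * (rho ^+ j * chi)^-1 = sigma j.
  rewrite invrM ?lin_char_unitr ?exp_lin_char // mulrA mulrK ?lin_char_unitr //.
have bE j : (j < d)%N -> j != h ->
    cbinom (eta ^+ (2 * j + 1) * chi) (rho ^+ j * chi) = s j / q * (f j * k j / D j).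
  by move=> jd jh; rewrite (cbinom_gauss thP) // quot // sigma_neq1.
(* The last quotient of parameters is thus inverse to the first one, which is [eta]. *)
have etaV : eta ^+ (2 * d - 1) = eta^-1.
  apply/esym/inv_of_mul => //; rewrite -exprS (_ : _.+1 = 2 * d)%N ?eta_2d //; lia.
have b0 : cbinom (eta * chi) chi = s 0%N / q * (f 0%N * k 0%N / g eta).
  by rewrite (cbinom_gauss thP) ?mul_lin_char ?mulrK ?lin_char_unitr ?eta_neq1 // /s /f /k !expr0 !mul1r expr1.
have bl : cbinom (eta ^+ (2 * d - 1) * chi) (1 * chi) =
    s 0%N / q * (f (2 * h)%N * k 0%N / g eta^-1).
  have e1 : (2 * d - 1 = 2 * (2 * h) + 1)%N by lia.
  rewrite (cbinom_gauss thP) ?mul1r ?mul_lin_char ?exp_lin_char ?mulrK ?lin_char_unitr //; last first.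
    by rewrite etaV invr_eq1 eta_neq1.
  by rewrite {2}etaV /s /f /k !expr0 !mul1r e1.
have -> : \prod_(j <- [seq j <- iota 1 (2 * h - 1) | j != h])
     cbinom (eta ^+ (2 * j + 1) * chi) (rho ^+ j * chi) =
  \prod_(j <- [seq j <- iota 1 (2 * h - 1) | j != h]) (s j / q * (f j * k j / D j)).
  rewrite big_seq [RHS]big_seq; apply: eq_bigr => j; rewrite mem_filter mem_iota.
  by case/andP => jh /andP[j1 j2]; rewrite bE //; lia.
rewrite !big_split /= !prodfV !prod_skip_middle //.
have -> : \prod_(1 <= j < h) (s j * s (2 * h - j)%N) = 1.
  rewrite big_nat big1 // => j /andP[j0 jh].
  rewrite /s !cextMl mulrACA -cextMl -exprD subnKC; last by lia.
  by rewrite rho_2h cext_cfun1 m1 mul1r -expr2 sgn_sq.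
have -> : \prod_(1 <= j < h) (q * q) = q ^+ (2 * h - 2).
  by rewrite prodr_const_nat -expr2 -exprM; congr (_ ^+ _); lia.
have -> : \prod_(j < d) g (eta * chi * (eta ^+ 2) ^+ j) =
    f 0%N * f h * \prod_(1 <= j < h) (f j * f (2 * h - j)%N) * f (2 * h)%N.
  rewrite -prod_pairs_even // addn1 big_ord_recr /=.
  have fE j : g (eta * chi * (eta ^+ 2) ^+ j) = f j.
    by rewrite /f mulrAC -exprM -exprS addn1.
  by rewrite fE; congr (_ * _); apply: eq_bigr => j _; rewrite fE.
have -> : \prod_(j < 2 * h) g (chi^-1 * rho^-1 ^+ j) =
    k 0%N * k h * \prod_(1 <= j < h) (k j * k (2 * h - j)%N).
  rewrite -prod_pairs_even //; apply: eq_bigr => j _.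
  by rewrite /k invrM ?lin_char_unitr ?exp_lin_char // exprVn.
rewrite b0 bl -prod_gauss_sigma.
have -> : g chi^-1 = k 0%N by rewrite /k expr0 mul1r.
have -> : g (phi * chi) = f h by rewrite /f eta_d.
have -> : g (phi * chi)^-1 = k h by rewrite /k rho_h.
rewrite -/(D _); set PD := \prod_(1 <= j < h) (D j * D (2 * h - j)%N).
have PD0 : PD != 0.
  rewrite /PD prodf_seq_neq0; apply/allP => j _ /=.
  by rewrite mulf_neq0 // gauss_neq0 // sigma_lin.
have g0 : g eta != 0 by rewrite gauss_neq0.
have g1 : g eta^-1 != 0 by rewrite gauss_neq0 ?inv_lin_char.
have fh0 : f h != 0 by rewrite gauss_neq0.
have kh0 : k h != 0 by exact: (gauss_neq0 thP (inv_lin_char (lk h))).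
have s0 : s 0%N * s 0%N = 1 by rewrite /s -expr2 sgn_sq.
have q0 := q_neq0 F.
have -> : q ^- (2 * h) = (q * q * q ^+ (2 * h - 2))^-1.
  by rewrite -[in LHS](subnKC (n := 2 * h) (m := 2)) ?leq_pmulr // exprD expr2.
have qh0 : q ^+ (2 * h - 2) != 0 by rewrite expf_neq0.
exact: hyp_term_algebra.
Qed.

End Main.

(** The cancellation in [hyp_coef]: [Q] is [q ^+ h.-1], [E] the product of the Gauss sums of
    [phi * chi] and its inverse, and [del] the weight of [chi]. *)
Lemma hyp_coef_algebra (R : fieldType)
    (q Q r pa pd p1 xd xh xa xb x1 G1 G2 k0 S gp E del : R) :
  [&& q != 0, Q != 0, r != 0, pd != 0, p1 != 0, xd != 0, xh != 0, xa != 0, S != 0 & E != 0] ->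
  gp * gp = q * p1 -> E * del = q * p1 * x1 ->
  q * Q * (p1 * pa * pd) *
   (q / r * ((q * Q * (q * Q))^-1 * (q * Q * ((pd * xd)^-1 * G1)) * (Q * S * gp * (xh * G2)) * k0 /
     (E * (q * Q * S * p1)) * (x1 * (xb * xd / (xa * xh))))) * gp =
  pa / r * (k0 * G1 * G2 * (xb / xa)) * del.
Proof.
case/and5P=> q0 Q0 r0 pd0 /and5P[p10 xd0 xh0 xa0 /andP[S0 E0]] gg ed.
have -> : del = (q * p1 * x1) / E by rewrite -ed mulrC mulKf.
transitivity (q * Q * (p1 * pa * pd) *
   (q / r * ((q * Q * (q * Q))^-1 * (q * Q * ((pd * xd)^-1 * G1)) * (Q * S * (xh * G2)) * k0 /
     (E * (q * Q * S * p1)) * (x1 * (xb * xd / (xa * xh))))) * (gp * gp)); first by ring.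
rewrite gg; field.
by rewrite q0 Q0 r0 pd0 p10 xd0 xh0 xa0 S0 E0.
Qed.

(** * Comparison of the series with the point count *)

Section Final.
Variables (F : finFieldType) (t : Iirr (UG F)) (th : F -> algC).
Hypothesis thP : additive_char th.
Hypothesis Tgen : forall i : Iirr (UG F), exists k : nat, 'chi_i = 'chi_t ^+ k.
Variables (h c : nat).
Hypotheses (h0 : (0 < h)%N) (nE : (#|F|.-1 = 2 * h * (2 * h + 1) * c)%N).
Variables a b : F.
Hypotheses (a0 : a != 0) (b0 : b != 0).
Local Notation T := ('chi_t).
Local Notation q := (#|F|%:R : algC).
Local Notation g := (gauss th).
Local Notation d := (2 * h + 1)%N.
Local Notation eta := (etaT t h c).
Local Notation rho := (rhoT t h c).
Local Notation phi := (phiT t h c).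

Let lphi : phi \is a linear_char := exp_lin_char _ (chi_lin t).
Let leta : eta \is a linear_char := exp_lin_char _ (chi_lin t).
Let lrho : rho \is a linear_char := exp_lin_char _ (chi_lin t).
Let phi2 : phi ^+ 2 = 1 . Proof. exact: phi_sqr. Qed.
Let phi1 : phi != 1 . Proof. exact: phi_neq1. Qed.
Let m1 : (-1 : F) != 0. Proof. by rewrite oppr_eq0 oner_eq0. Qed.

Let dF : d%:R != 0 :> F.
Proof. by apply: natr_dvd_card_neq0; rewrite nE -mulnA dvdn_mull // dvdn_mulr. Qed.
Let hF : (2 * h)%:R != 0 :> F.
Proof. by apply: natr_dvd_card_neq0; rewrite nE -mulnA dvdn_mulr. Qed.
Let F2 : 2%:R != 0 :> F.
Proof. by apply: natr_dvd_card_neq0; rewrite nE -!mulnA dvdn_mulr. Qed.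

Definition beta : F := b * d%:R ^+ d / (a ^+ d * (2 * h)%:R ^+ (2 * h)).

Definition point_term (chi : 'CF(UG F)) : algC :=
  g chi^-1 * g (phi * chi ^+ d) * g (chi^-1 ^+ (2 * h)) * cext chi (b / a ^+ d).

(** The weight comes from the divided-out factor [g (phi * chi) * g (phi * chi)^-1], which is [1]
    for [chi = phi] and [q] times a sign otherwise. *)
Lemma hyp_coef (chi : 'CF(UG F)) : chi \is a linear_char ->
  q ^+ h * (cext phi (-1) * cext phi a * cext phi d%:R) *
  (q / (q - 1) *
   (cbinom (eta * chi) chi *
    \prod_(j <- [seq j <- iota 1 (2 * h - 1) | j != h])
       cbinom (eta ^+ (2 * j + 1) * chi) (rho ^+ j * chi) *
    cbinom (eta ^+ (2 * d - 1) * chi) (1 * chi) * cext chi (- beta))) * g phi =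
  cext phi a / (q - 1) * point_term chi * (if chi == phi then q else 1).
Proof.
move=> lchi; rewrite (hyp_term thP Tgen h0 nE) //.
rewrite (prod_gauss_eta thP Tgen h0 nE) ?mul_lin_char // (prod_gauss_rho thP Tgen h0 nE) ?inv_lin_char //.
have dE : cext ((eta * chi) ^+ d) d%:R^-1 = (cext phi d%:R * cext chi d%:R ^+ d)^-1.
  by rewrite exprMn eta_d // cextMl (cextV _ lphi) [cext (chi ^+ _) _]cextXl ?invr_neq0 // cextV // exprVn invfM.
have hE : cext (chi^-1 ^+ (2 * h)) (2 * h)%:R^-1 = cext chi (2 * h)%:R ^+ (2 * h).
  by rewrite cextXl ?invr_neq0 // cextVl // cextV // invrK.
have bE : cext chi (- beta) = cext chi (-1) * (cext chi b * cext chi d%:R ^+ d /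
    (cext chi a ^+ d * cext chi (2 * h)%:R ^+ (2 * h))).
  by rewrite -[- beta]mulN1r /beta !cextM // cextV // cextM // !cextX.
have baE : cext chi (b / a ^+ d) = cext chi b / cext chi a ^+ d.
  by rewrite cextM // cextV // cextX.
rewrite dE hE bE /point_term baE exprMn eta_d //.
have -> : q ^- (2 * h) = (q * q ^+ h.-1 * (q * q ^+ h.-1))^-1.
  by rewrite -exprS prednK // mul2n -addnn exprD.
have -> : q ^+ h = q * q ^+ h.-1 by rewrite -exprS prednK.
apply: hyp_coef_algebra.
- have lpc : phi * chi \is a linear_char by rewrite mul_lin_char.
  rewrite q_neq0 expf_neq0 ?q_neq0 // q1_neq0 !expf_neq0 ?cext_neq0 //=.
  rewrite /sgn_rho prodf_seq_neq0 mulf_neq0 ?(gauss_neq0 thP) ?inv_lin_char // andbT.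
  by apply/allP => j _ /=; exact: cext_neq0 (exp_lin_char j lrho) m1.
- by have := gauss_mulV thP lphi; rewrite (phiV lphi phi2) (negPf phi1).
rewrite gauss_mulV ?mul_lin_char //.
case: eqVneq => [ep|np].
  have -> : chi = phi by apply: (mulrI (lin_char_unitr lphi)); rewrite ep -phi2.
  by rewrite eqxx -mulrA -expr2 phi_sq // mulr1 mul1r.
have /negPf -> : chi != phi by apply: contraNneq np => ->; rewrite -phi2.
by rewrite mulr1 cextMl mulrA.
Qed.

Lemma Nd_gaussHyp (phiK : forall c : F, c != 0 ->
    (cext phi c == 1) = (c ^+ (#|F|.-1 %/ 2) == 1)) :
  (Nd d a b)%:R = q + q ^+ h * qchar (- a * d%:R) *
   gaussHyp eta (rcons [seq eta ^+ (2 * j + 1) | j <- [seq j <- iota 1 (2 * h - 1) | j != h]]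
                       (eta ^+ (2 * d - 1)))
                (rcons [seq rho ^+ j | j <- [seq j <- iota 1 (2 * h - 1) | j != h]] 1) (- beta).
Proof.
have dv : (2 %| #|F|.-1)%N by rewrite nE -!mulnA dvdn_mulr.
have qc z : qchar z = cext phi z by apply: qchar_cext.
have od : odd d by rewrite oddD oddM.
have d1 : (1 < d)%N by rewrite addn1 ltnS muln_gt0.
have gphi : g phi != 0 by rewrite gauss_neq0.
rewrite Nd_sum //; congr (_ + _); apply: (mulfI gphi).
rewrite (eq_bigr _ (fun x _ => qc _)) qc (point_sum thP) //.
rewrite /gaussHyp zip_rcons ?size_map // zip_map.
have -> : cext phi (- a * d%:R) = cext phi (-1) * cext phi a * cext phi d%:R.
  by rewrite -[- a]mulN1r !cextM.
transitivity (\sum_(i : Iirr (UG F)) cext phi a / (q - 1) * point_term 'chi_i *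
   (if 'chi_i == phi then q else 1)); last first.
  rewrite !mulr_sumr; apply: eq_bigr => i _; rewrite -hyp_coef ?chi_lin // mulrC.
  rewrite -cats1 big_cat big_map big_seq1 /=; congr (_ * (_ * (_ * (_ * _)))).
  by rewrite mulrA.
(* The excess weight [q - 1] at [phi] reproduces the term [x = 0] of the character sum: two of the
   three Gauss sums are those of the trivial character. *)
have Pphi : cext phi a / (q - 1) * point_term phi * (q - 1) = g phi * cext phi b.
  have pe : phi ^+ (2 * h) = 1 by rewrite exprM phi2 expr1n.
  rewrite /point_term (phiV lphi phi2) exprD pe mul1r expr1 -expr2 phi2 gauss1 //.
  rewrite cextM // cextV // cextX // exprD exprM phi_sq // expr1n mul1r expr1.
  by field; rewrite q1_neq0 cext_neq0.
have [i0 ei0] : exists i0, phi = 'chi_i0 by apply/irrP; apply: lin_char_irr.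
have dE : d.-1 = (2 * h)%N by rewrite addn1.
rewrite mulr_sumr dE -/(point_term _) (bigD1 i0) // [RHS](bigD1 i0) //= -ei0 eqxx.
rewrite [X in _ = _ + X](eq_bigr (fun i => cext phi a / (q - 1) * point_term 'chi_i)); last first.
  move=> i ii0; case: eqP => [e|]; last by rewrite mulr1.
  by case/eqP: ii0; apply: irr_inj; rewrite -ei0 -e.
rewrite addrA; congr (_ + _); rewrite -Pphi -/(point_term phi); ring.
Qed.

End Final.

Theorem theorem1p4 (F : finFieldType) (d : nat) (a b : F) (t : Iirr (UG F)) :
  odd d -> (3 <= d)%N -> (d * (d - 1) %| #|F| - 1)%N ->
  a != 0 -> b != 0 ->
  (forall i : Iirr (UG F), exists k : nat, 'chi_i = 'chi_t ^+ k) ->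
  let T := 'chi_t in
  let q := #|F| in
  let eta := T ^+ ((q - 1) %/ (2 * d)) in
  let rho := T ^+ ((q - 1) %/ (d - 1)) in
  let js := [seq j <- iota 1 (d - 2) | j != (d - 1)./2] in
  let As := rcons [seq eta ^+ (2 * j + 1) | j <- js] (eta ^+ (2 * d - 1)) in
  let Bs := rcons [seq rho ^+ j | j <- js] 1 in
  let beta := b * (d%:R) ^+ d / (a ^+ d * ((d - 1)%:R) ^+ (d - 1)) in
  (Nd d a b)%:R = q%:R + (q%:R) ^+ ((d - 1)./2) * qchar (- a * d%:R)
                  * gaussHyp eta As Bs (- beta).
Proof.
move=> od d3 /dvdnP[c nc] a0 b0 Tgen; cbv zeta.
have [h dE] : exists h, d = (2 * h + 1)%N.
  by exists d./2; rewrite mul2n addn1 -[LHS]odd_double_half od.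
subst d; have h0 : (0 < h)%N by lia.
have nE : #|F|.-1 = (2 * h * (2 * h + 1) * c)%N by rewrite -subn1 nc addnK; lia.
have [th thP] := additive_char_exists F.
have -> : (2 * h + 1 - 1 = 2 * h)%N by rewrite addnK.
have -> : (2 * h + 1 - 2 = 2 * h - 1)%N by lia.
have -> : ((2 * h)./2 = h)%N by rewrite mul2n doubleK.
rewrite subn1.
have -> : (#|F|.-1 %/ (2 * (2 * h + 1)) = h * c)%N.
  by rewrite nE (_ : 2 * h * (2 * h + 1) * c = h * c * (2 * (2 * h + 1)))%N ?mulnK //; lia.
have -> : (#|F|.-1 %/ (2 * h) = (2 * h + 1) * c)%N.
  by rewrite nE -mulnA mulKn //; lia.
apply: (Nd_gaussHyp thP Tgen h0 nE a0 b0) => x x0.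
have -> : phiT t h c = 'chi_t ^+ (#|F|.-1 %/ 2).
  by congr (_ ^+ _); rewrite nE (_ : 2 * h * (2 * h + 1) * c = h * (2 * h + 1) * c * 2)%N ?mulnK //; lia.
exact: T_kummer.
Qed.
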